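(* Let $n\ge 1$ and let $\phi$ be an $R$-algebra endomorphism of $A^{(t)}_n$. Then for almost every (that is, all but finitely many) root of unity $q\in\mathbb{C}^*$ we have $\phi_q(Z^q_n)\subseteq Z^q_n$.
   Context: Let $R=\mathbb{C}[t,t^{-1}]$. For $n\ge 1$ the quantized Weyl algebra is $A^{(t)}_n=R\langle x_1,\dots,x_n,\partial_1,\dots,\partial_n\rangle/I_t$, where $I_t$ is the two-sided ideal generated by $\partial_i x_j-t^{\delta_{ij}}x_j\partial_i-\delta_{ij}$, $x_ix_j-x_jx_i$ and $\partial_i\partial_j-\partial_j\partial_i$ for $1\le i,j\le n$. For $q\in\mathbb{C}^*$, $A^q_n=A^{(t)}_n/(t-q)$, and $Z^q_n$ denotes the center of $A^q_n$; if $q$ is a primitive $l$-th root of unity with $l>1$ then $Z^q_n=\mathbb{C}[x_1^l,\dots,x_n^l,\partial_1^l,\dots,\partial_n^l]$. An $R$-algebra endomorphism $\phi$ of $A^{(t)}_n$ induces, by reduction modulo $t-q$, a $\mathbb{C}$-algebra endomorphism $\phi_q$ of $A^q_n$. *)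

(* Defs.v *)
From HB Require Import structures.
From mathcomp Require Import all_boot all_order all_algebra.
From mathcomp Require Import generic_quotient ring_quotient.
From mathcomp Require Import boolp classical_sets cardinality reals complex.
From mathcomp Require Import finmap monalg.

Set Implicit Arguments.
Unset Strict Implicit.
Unset Printing Implicit Defensive.

Import GRing.Theory Quotient.

Local Open Scope classical_set_scope.
Local Open Scope quotient_scope.
Local Open Scope ring_scope.

Section TwoSidedIdeals.
Variable A : pzRingType.

Definition two_sided_ideal (I : set A) : Prop :=
  [/\ I 0, forall x y, I x -> I y -> I (x - y)
    & forall a x b, I x -> I (a * x * b)].

Definition ideal_gen (S : set A) : set A := smallest two_sided_ideal S.

Lemma ideal_gen_ideal S : two_sided_ideal (ideal_gen S).
Proof.
split=> [I [[]]//|x y Ix Iy I II|a x b Ix I II].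
  by case: (II) => -[_ h _] _; apply: h; [apply: Ix|apply: Iy].
by case: (II) => -[_ _ h] _; apply: h; apply: Ix.
Qed.

Lemma sub_ideal_gen S : S `<=` ideal_gen S.
Proof. exact: sub_gen_smallest. Qed.

Lemma ideal_gen_min (S I : set A) :
  two_sided_ideal I -> S `<=` I -> ideal_gen S `<=` I.
Proof. exact: smallest_sub. Qed.

Definition ideal_pred (S : set A) : {pred A} := mem (ideal_gen S).

Lemma ideal_predP S x : reflect (ideal_gen S x) (x \in ideal_pred S).
Proof. by apply: (iffP idP) => [/set_mem|/mem_set]. Qed.

Lemma ideal_pred_zmod_closed S : zmod_closed (ideal_pred S).
Proof.
have [h0 hB _] := ideal_gen_ideal S.
split=> [|x y /ideal_predP Ix /ideal_predP Iy]; first exact/ideal_predP.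
by apply/ideal_predP; apply: hB.
Qed.
HB.instance Definition _ S :=
  GRing.isZmodClosed.Build A (ideal_pred S) (ideal_pred_zmod_closed S).

(* ring_quotient only gives {quot I} a ring structure when the ring is
   commutative and I is proper; here the ring is arbitrary and the quotient may
   be trivial. *)
Definition quot_ring (S : set A) : Type := {quot (ideal_pred S)}.
HB.instance Definition _ S := GRing.Zmodule.on (quot_ring S).
HB.instance Definition _ S : EqQuotient A (equiv (ideal_pred S)) (quot_ring S)
  := EqQuotient.on (quot_ring S).
HB.instance Definition _ S := ZmodQuotient.on (quot_ring S).

Variable S : set A.
Local Notation Q := (quot_ring S).

Definition quot_proj : A -> Q := \pi_Q.

Lemma quot_projE x y : quot_proj x = quot_proj y <-> ideal_gen S (x - y).
Proof.
split=> [/eqP|h]; last first.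
  by apply/eqP; rewrite /quot_proj piE equivE; apply/ideal_predP.
by rewrite /quot_proj piE equivE => /ideal_predP.
Qed.

Lemma quot_projK : cancel repr quot_proj.
Proof. exact: reprK. Qed.

Lemma quot_repr x : ideal_gen S (repr (quot_proj x) - x).
Proof. by apply/quot_projE; rewrite quot_projK. Qed.

Lemma quot_proj0 : quot_proj 0 = 0.
Proof. exact: raddf0. Qed.

Lemma quot_projB : zmod_morphism quot_proj.
Proof. exact: raddfB. Qed.
HB.instance Definition _ := GRing.isZmodMorphism.Build A Q quot_proj quot_projB.

End TwoSidedIdeals.

(* Locked, so that comparing two products in a quotient does not compute with
   representatives. *)
HB.lock Definition quot_mul (A : pzRingType) (S : set A) (x y : quot_ring S) :
  quot_ring S := quot_proj S (repr x * repr y).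

HB.lock Definition quot_scale (R : pzRingType) (A : lalgType R) (S : set A)
  (r : R) (x : quot_ring S) : quot_ring S := quot_proj S (r *: repr x).

Section QuotientRing.
Variables (A : pzRingType) (S : set A).
Local Notation Q := (quot_ring S).
Local Notation quot_mul := (@quot_mul A S).
Local Notation quot_proj := (quot_proj S).

Lemma quot_proj_mul x y :
  quot_mul (quot_proj x) (quot_proj y) = quot_proj (x * y).
Proof.
rewrite unlock; apply/quot_projE; have [_ hB hM] := ideal_gen_ideal S.
set x' := repr _; set y' := repr _.
have -> : x' * y' - x * y = (1 * (x' - x) * y') - (- x * (y' - y) * 1).
  by rewrite mul1r mulr1 mulNr opprK mulrBl mulrBr addrA subrK.
by apply: hB; apply: hM; apply: quot_repr.
Qed.

Lemma quot_mulA : associative quot_mul.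
Proof.
move=> x y z; rewrite -[x]quot_projK -[y]quot_projK -[z]quot_projK.
by rewrite !quot_proj_mul mulrA.
Qed.

Lemma quot_mul1 : left_id (quot_proj 1) quot_mul.
Proof. by move=> x; rewrite -[x]quot_projK quot_proj_mul mul1r. Qed.

Lemma quot_mulr1 : right_id (quot_proj 1) quot_mul.
Proof. by move=> x; rewrite -[x]quot_projK quot_proj_mul mulr1. Qed.

Lemma quot_mulDl : left_distributive quot_mul +%R.
Proof.
move=> x y z; rewrite -[x]quot_projK -[y]quot_projK -[z]quot_projK.
by rewrite -raddfD !quot_proj_mul mulrDl raddfD.
Qed.

Lemma quot_mulDr : right_distributive quot_mul +%R.
Proof.
move=> x y z; rewrite -[x]quot_projK -[y]quot_projK -[z]quot_projK.
by rewrite -raddfD !quot_proj_mul mulrDr raddfD.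
Qed.

HB.instance Definition _ := GRing.Zmodule_isPzRing.Build Q
  quot_mulA quot_mul1 quot_mulr1 quot_mulDl quot_mulDr.

Lemma quot_proj_monoid : monoid_morphism quot_proj.
Proof. by split=> // x y; rewrite -quot_proj_mul. Qed.
HB.instance Definition _ :=
  GRing.isMonoidMorphism.Build A Q quot_proj quot_proj_monoid.

End QuotientRing.

Lemma ideal_gen_morph (A B : pzRingType) (f : {rmorphism A -> B})
    (S : set A) (T : set B) : (forall s, S s -> ideal_gen T (f s)) ->
  forall a, ideal_gen S a -> ideal_gen T (f a).
Proof.
move=> fST; suff: ideal_gen S `<=` [set a | ideal_gen T (f a)] by [].
have [T0 TB TM] := ideal_gen_ideal T.
apply: ideal_gen_min => //; split=> [|x y fx fy|a x b fx] /=.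
- by rewrite rmorph0.
- by rewrite rmorphB; apply: TB.
- by rewrite !rmorphM; apply: TM.
Qed.

Section QuotientModule.
Variables (R : pzRingType) (A : lalgType R) (S : set A).
Local Notation Q := (quot_ring S).
Local Notation quot_scale := (@quot_scale R A S).

Lemma quot_proj_scale r x : quot_scale r (quot_proj S x) = quot_proj S (r *: x).
Proof.
rewrite unlock; apply/quot_projE; have [_ _ hM] := ideal_gen_ideal S.
rewrite -scalerBr -mulr_algl -[_ * _]mulr1.
by apply: hM; apply: quot_repr.
Qed.

Lemma quot_scaleA a b v : quot_scale a (quot_scale b v) = quot_scale (a * b) v.
Proof. by rewrite -[v]quot_projK !quot_proj_scale scalerA. Qed.

Lemma quot_scale1 : left_id 1 quot_scale.
Proof. by move=> v; rewrite -[v]quot_projK quot_proj_scale scale1r. Qed.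

Lemma quot_scaleDr : right_distributive quot_scale +%R.
Proof.
move=> r x y; rewrite -[x]quot_projK -[y]quot_projK.
by rewrite -raddfD !quot_proj_scale scalerDr raddfD.
Qed.

Lemma quot_scaleDl v : {morph quot_scale^~ v : a b / a + b}.
Proof.
move=> a b /=; rewrite -[v]quot_projK.
by rewrite !quot_proj_scale scalerDl raddfD.
Qed.

HB.instance Definition _ := GRing.Zmodule_isLmodule.Build R Q
  quot_scaleA quot_scale1 quot_scaleDr quot_scaleDl.

Lemma quot_proj_scalable : scalable (quot_proj S : A -> Q).
Proof. by move=> r x; rewrite -quot_proj_scale. Qed.
HB.instance Definition _ := GRing.isScalable.Build R A Q *:%R (quot_proj S)
  quot_proj_scalable.

Lemma quot_scaleAl (r : R) (x y : Q) : r *: (x * y) = (r *: x) * y.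
Proof.
rewrite -[x]quot_projK -[y]quot_projK -rmorphM -!linearZ -rmorphM.
by rewrite scalerAl.
Qed.

End QuotientModule.

Definition center (A : pzRingType) : set A := [set z | forall a, GRing.comm z a].
Arguments center A : clear implicits.

Definition is_root_of_unity (F : fieldType) (q : F) : Prop :=
  exists2 l : nat, (0 < l)%N & l.-unity_root q.

Section Laurent.
Variable F : fieldType.
Local Notation frac := {fraction {poly F}}.
Local Notation "p %:F" := (tofrac p).

(* F[t, t^-1], as the subring of F(t) of the fractions p / t^k. *)
Definition laurent_pred : {pred frac} :=
  [pred f : frac | `[< exists (p : {poly F}) (k : nat), f = p%:F / ('X^k)%:F >]].

Lemma tofracXn_neq0 k : ('X^k : {poly F})%:F != 0.
Proof. by rewrite tofrac_eq0 monic_neq0 ?monicXn. Qed.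

Lemma laurent_subring_closed : subring_closed laurent_pred.
Proof.
split=> [|_ _ /asboolP[p [k ->]] /asboolP[r [l ->]]
         |_ _ /asboolP[p [k ->]] /asboolP[r [l ->]]]; apply/asboolP.
- by exists 1, 0%N; rewrite expr0 tofrac1 divr1.
- exists (p * 'X^l - r * 'X^k), (k + l)%N.
  rewrite exprD tofracM tofracB !tofracM mulrBl.
  have mfracK (a b c : frac) : c != 0 -> a * c / (b * c) = a / b.
    by move=> c0; rewrite -mulf_div divff // mulr1.
  rewrite mfracK ?tofracXn_neq0// [X in _ = _ - _ / X]mulrC.
  by rewrite mfracK ?tofracXn_neq0.
- by exists (p * r), (k + l)%N; rewrite exprD !tofracM mulf_div.
Qed.
HB.instance Definition _ :=
  GRing.isSubringClosed.Build frac laurent_pred laurent_subring_closed.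

Record laurent := Laurent { laurent_val :> frac; _ : laurent_val \in laurent_pred }.
HB.instance Definition _ := [isSub for laurent_val].
HB.instance Definition _ := [Choice of laurent by <:].
HB.instance Definition _ := [SubChoice_isSubComNzRing of laurent by <:].
HB.instance Definition _ :=
  GRing.RMorphism.copy laurent_val (\val : laurent -> frac).

Fact laurent_poly_subproof (p : {poly F}) : p%:F \in laurent_pred.
Proof. by apply/asboolP; exists p, 0%N; rewrite expr0 tofrac1 divr1. Qed.

Definition laurent_poly (p : {poly F}) : laurent :=
  Laurent (laurent_poly_subproof p).

Definition lvar : laurent := laurent_poly 'X.
Definition lconst (c : F) : laurent := laurent_poly c%:P.

End Laurent.

Lemma malg_scaleAr (R : comNzRingType) (M : monomType) (r : R)
  (a b : {malg R[M]}) : r *: (a * b) = a * (r *: b).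
Proof.
apply/malgP => k; rewrite mcoeffZ.
rewrite [in LHS](mcoeffMlw k (fsubset_refl (msupp a)) (fsubset_refl (msupp b))).
rewrite (mcoeffMlw k (fsubset_refl (msupp a)) (msuppZ_le r b)).
rewrite mulr_sumr; apply: eq_bigr => k1 _; rewrite mulr_sumr.
by apply: eq_bigr => k2 _; rewrite mcoeffZ mulrnAr mulrCA.
Qed.

Section WeylRelations.
Variables (R : comNzRingType) (t : R) (n : nat).

Definition weyl_rel (A : lalgType R) (x d : 'I_n -> A) : set A :=
  [set r | exists i j : 'I_n,
     [\/ r = d i * x j - t ^+ (i == j) *: (x j * d i) - (i == j)%:R,
         r = x i * x j - x j * x i
       | r = d i * d j - d j * d i]].

Lemma weyl_rel_char (A : lalgType R) (x d : 'I_n -> A) (K : comNzRingType)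
    (f : {rmorphism R -> K}) (chi : {rmorphism A -> K}) :
    (forall r a, chi (r *: a) = f r * chi a) ->
    (forall i j, chi (d i) * chi (x j)
       - f t ^+ (i == j) * (chi (x j) * chi (d i)) - (i == j)%:R = 0) ->
  forall a, ideal_gen (weyl_rel x d) a -> chi a = 0.
Proof.
move=> chiZ chi0; suff: ideal_gen (weyl_rel x d) `<=` [set a | chi a = 0] by [].
apply: ideal_gen_min => [|_ [i [j []->]]] /=.
- split=> /= [|a b ha hb|b a c ha]; first by rewrite rmorph0.
  + by rewrite rmorphB ha hb subrr.
  + by rewrite !rmorphM ha mulr0 mul0r.
- rewrite !rmorphB chiZ !rmorphM rmorph_nat rmorphXn.
  exact: chi0.
- by rewrite rmorphB !rmorphM mulrC subrr.
- by rewrite rmorphB !rmorphM mulrC subrr.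
Qed.

Local Notation free_alg := {malg R[{fmonom ('I_n + 'I_n)%type}]}.

Definition free_x (i : 'I_n) : free_alg := mkmalgU (fmu (inl i)) 1.
Definition free_d (i : 'I_n) : free_alg := mkmalgU (fmu (inr i)) 1.

Definition weyl_alg : Type := quot_ring (weyl_rel free_x free_d).
HB.instance Definition _ := GRing.PzRing.on weyl_alg.
HB.instance Definition _ := GRing.Lmodule.on weyl_alg.

Lemma weyl_scaleAl (r : R) (x y : weyl_alg) : r *: (x * y) = (r *: x) * y.
Proof. exact: quot_scaleAl. Qed.

Lemma weyl_scaleAr (r : R) (x y : weyl_alg) : r *: (x * y) = x * (r *: y).
Proof.
rewrite -[x]quot_projK -[y]quot_projK -rmorphM -!linearZ -rmorphM.
by rewrite malg_scaleAr.
Qed.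

(* When 1 - t becomes invertible in K, x_i |-> 1, d_i |-> 1 / (1 - t) is a
   character of weyl_alg. *)
Section Character.
Variables (K : fieldType) (f : {rmorphism R -> K}).
Hypothesis ft_neq1 : 1 - f t != 0.

Definition weyl_char_mon (m : {fmonom ('I_n + 'I_n)%type}) : K :=
  \prod_(g <- (m : seq _)) if g is inl _ then 1 else (1 - f t)^-1.

Fact weyl_char_mon_mmorph : mmorphism weyl_char_mon.
Proof.
by split=> [x y|]; rewrite /weyl_char_mon ?fmM ?big_cat ?fm1 ?big_nil.
Qed.
HB.instance Definition _ :=
  isMultiplicative.Build _ _ weyl_char_mon weyl_char_mon_mmorph.

Definition weyl_char : free_alg -> K := mmap f weyl_char_mon.
HB.instance Definition _ :=
  GRing.RMorphism.copy weyl_char (mmap f weyl_char_mon).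

Lemma weyl_charU m : weyl_char (mkmalgU m 1) = weyl_char_mon m.
Proof. by rewrite /weyl_char mmapU /= rmorph1 mul1r. Qed.

Lemma weyl_char_x i : weyl_char (free_x i) = 1.
Proof. by rewrite weyl_charU /weyl_char_mon fmU big_seq1. Qed.

Lemma weyl_char_d i : weyl_char (free_d i) = (1 - f t)^-1.
Proof. by rewrite weyl_charU /weyl_char_mon fmU big_seq1. Qed.

Lemma weyl_charZ r a : weyl_char (r *: a) = f r * weyl_char a.
Proof. exact: mmapZ. Qed.

Lemma weyl_char_rel a : ideal_gen (weyl_rel free_x free_d) a -> weyl_char a = 0.
Proof.
apply: (weyl_rel_char weyl_charZ) => i j.
rewrite /= (weyl_char_x j) (weyl_char_d i) mulr1 mul1r.
case: (i == j); last by rewrite expr0 mul1r subrr subr0.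
by rewrite expr1 -[X in X - f t * _]mul1r -mulrBl mulfV// subrr.
Qed.

Lemma weyl_oner_neq0 : (1 : weyl_alg) != 0.
Proof.
apply/eqP; rewrite -(rmorph1 (quot_proj (weyl_rel free_x free_d))).
rewrite -(quot_proj0 (weyl_rel free_x free_d)).
move/quot_projE/weyl_char_rel; rewrite subr0 rmorph1 => /eqP.
by rewrite oner_eq0.
Qed.

End Character.
End WeylRelations.

Section QuantizedWeyl.
Variables (F : fieldType) (n : nat).
Local Notation R := (laurent F).
Local Notation t := (lvar F).

Lemma one_sub_lvar_neq0 : 1 - laurent_val t != 0.
Proof.
rewrite -tofrac1 -tofracB tofrac_eq0 subr_eq0 eq_sym.
apply/eqP => /(congr1 (fun p : {poly F} => size p)).
by rewrite size_polyX size_poly1.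
Qed.

Definition qweyl : Type := weyl_alg t n.
HB.instance Definition _ := GRing.PzRing.on qweyl.
HB.instance Definition _ := GRing.Lmodule.on qweyl.
HB.instance Definition _ := GRing.PzSemiRing_isNonZero.Build qweyl
  (weyl_oner_neq0 n one_sub_lvar_neq0).
HB.instance Definition _ := GRing.Lmodule_isLalgebra.Build R qweyl
  (@weyl_scaleAl R t n).
HB.instance Definition _ := GRing.Lalgebra_isAlgebra.Build R qweyl
  (@weyl_scaleAr R t n).

Definition qweyl_at (q : F) : Type :=
  quot_ring [set (t - lconst q)%:A : qweyl].
HB.instance Definition _ q := GRing.PzRing.on (qweyl_at q).
HB.instance Definition _ q := GRing.Lmodule.on (qweyl_at q).

Definition qweyl_proj (q : F) : qweyl -> qweyl_at q := quot_proj _.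
HB.instance Definition _ q := GRing.RMorphism.on (qweyl_proj q).
HB.instance Definition _ q := GRing.Linear.copy (qweyl_proj q)
  (quot_proj [set (t - lconst q)%:A : qweyl]).

(* The map induced on qweyl_at q by an R-linear ring endomorphism phi; see
   qweyl_inducedE. *)
Definition qweyl_induced (q : F) (phi : qweyl -> qweyl) :
  qweyl_at q -> qweyl_at q := fun z => qweyl_proj q (phi (repr z)).

Section Induced.
Variables (q : F) (phi : {lrmorphism qweyl -> qweyl}).
Local Notation phi_q := (qweyl_induced phi : qweyl_at q -> qweyl_at q).

Lemma qweyl_inducedE a : phi_q (qweyl_proj q a) = qweyl_proj q (phi a).
Proof.
apply/quot_projE; rewrite -rmorphB.
pose S : set qweyl := [set (t - lconst q)%:A].
have phiS s : S s -> ideal_gen S (phi s).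
  by move=> ->; rewrite linearZ /= rmorph1; apply: sub_ideal_gen.
exact: (ideal_gen_morph phiS) (quot_repr a).
Qed.

Let projK (z : qweyl_at q) : qweyl_proj q (repr z) = z.
Proof. exact: quot_projK. Qed.

Lemma qweyl_induced_zmod : zmod_morphism phi_q.
Proof.
move=> x y; rewrite -[x]projK -[y]projK.
by rewrite -raddfB !qweyl_inducedE !raddfB.
Qed.
HB.instance Definition _ := GRing.isZmodMorphism.Build _ _ phi_q
  qweyl_induced_zmod.

Lemma qweyl_induced_monoid : monoid_morphism phi_q.
Proof.
split=> [|x y]; first by rewrite -(rmorph1 (qweyl_proj q)) qweyl_inducedE !rmorph1.
rewrite -[x]projK -[y]projK.
by rewrite -rmorphM !qweyl_inducedE !rmorphM.
Qed.
HB.instance Definition _ := GRing.isMonoidMorphism.Build _ _ phi_q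
  qweyl_induced_monoid.

Lemma qweyl_induced_scalable : scalable phi_q.
Proof.
by move=> r x; rewrite -[x]projK -linearZ !qweyl_inducedE !linearZ.
Qed.
HB.instance Definition _ := GRing.isScalable.Build R _ _ *:%R phi_q
  qweyl_induced_scalable.

End Induced.
End QuantizedWeyl.

(* Main.v *)
(* Fix a root of unity q <> 1 of order l. The normal forms x^a d^b are a basis
   of A^q, whose leading monomials are multiplicative; so A^q is a domain and it
   is free of rank l^(2n) over its central polynomial subring
   Z0 = C[x_i^l, d_i^l]. Put x'_i = phi_q(x_i), d'_i = phi_q(d_i) and
   u'_i = d'_i x'_i - x'_i d'_i. From u'_i x'_j = q^(i == j) x'_j u'_i, the
   l^(2n) monomials m = x'^a u'^b with exponents below l satisfy
   z m = lambda m z for every z among the x'_i and u'_i, with pairwise distinct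
   systems of scalars lambda. If no x'_i or u'_i vanishes, they are hence
   independent over Z0, so every element of A^q has a nonzero Z0-multiple in
   their span. As phi_q(z), for z central, commutes with all of them, it is
   central. Now x'_i never vanishes, and [phi(d_i), phi(x_i)] specializes to 1
   at t = 1, so it is nonzero in A^(t) and its coefficients vanish
   simultaneously at finitely many q only. *)
From HB Require Import structures.
Require Import Defs.
From mathcomp Require Import all_boot all_order all_algebra.
From mathcomp Require Import boolp classical_sets cardinality reals complex.
From mathcomp Require Import generic_quotient fraction mpoly ring.
From mathcomp Require monalg.

Set Implicit Arguments.
Unset Strict Implicit.
Unset Printing Implicit Defensive.

Import Order.TTheory GRing.Theory.

Local Open Scope ring_scope.

(** * Additive maps and linear dependence over a domain *)

Section Endomorphisms.
(* The ring structure on [V] only serves to make its endomorphism ring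
   nontrivial: the endomorphisms are merely additive. *)
Variable V : nzRingType.

Record endo := Endo { endo_fun :> V -> V; endoB : zmod_morphism endo_fun }.

HB.instance Definition _ := gen_eqMixin endo.
HB.instance Definition _ := gen_choiceMixin endo.
HB.instance Definition _ (f : endo) :=
  GRing.isZmodMorphism.Build V V f (endoB f).

Lemma endoP (f g : endo) : f =1 g -> f = g.
Proof.
case: f g => [f fB] [g gB] /= /funext fg; subst g.
by congr Endo; apply: Prop_irrelevance.
Qed.

Fact endo_id_subproof : zmod_morphism (@id V). Proof. by []. Qed.
Fact endo_zero_subproof : zmod_morphism (fun _ : V => 0 : V).
Proof. by move=> x y; rewrite subr0. Qed.
Fact endo_opp_subproof (f : endo) : zmod_morphism (fun x => - f x).
Proof. by move=> x y; rewrite raddfB opprD. Qed.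
Fact endo_add_subproof (f g : endo) : zmod_morphism (fun x => f x + g x).
Proof. by move=> x y; rewrite !raddfB opprD addrACA. Qed.
Fact endo_mul_subproof (f g : endo) : zmod_morphism (fun x => f (g x)).
Proof. by move=> x y; rewrite !raddfB. Qed.

Definition endo_id := Endo endo_id_subproof.
Definition endo_zero := Endo endo_zero_subproof.
Definition endo_opp f := Endo (endo_opp_subproof f).
Definition endo_add f g := Endo (endo_add_subproof f g).
Definition endo_mul f g := Endo (endo_mul_subproof f g).

Fact endo_addA : associative endo_add.
Proof. by move=> f g h; apply: endoP => x /=; rewrite addrA. Qed.
Fact endo_addC : commutative endo_add.
Proof. by move=> f g; apply: endoP => x /=; rewrite addrC. Qed.
Fact endo_add0 : left_id endo_zero endo_add.
Proof. by move=> f; apply: endoP => x /=; rewrite add0r. Qed.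
Fact endo_addN : left_inverse endo_zero endo_opp endo_add.
Proof. by move=> f; apply: endoP => x /=; rewrite addNr. Qed.
HB.instance Definition _ :=
  GRing.isZmodule.Build endo endo_addA endo_addC endo_add0 endo_addN.

Fact endo_mulA : associative endo_mul.
Proof. by move=> f g h; apply: endoP. Qed.
Fact endo_mul1 : left_id endo_id endo_mul.
Proof. by move=> f; apply: endoP. Qed.
Fact endo_mulr1 : right_id endo_id endo_mul.
Proof. by move=> f; apply: endoP. Qed.
Fact endo_mulDl : left_distributive endo_mul +%R.
Proof. by move=> f g h; apply: endoP. Qed.
Fact endo_mulDr : right_distributive endo_mul +%R.
Proof. by move=> f g h; apply: endoP => x /=; rewrite raddfD. Qed.
Fact endo_id_neq0 : endo_id != 0.
Proof.
apply/eqP => /(congr1 (fun f : endo => f 1)) /= /eqP.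
by rewrite oner_eq0.
Qed.
HB.instance Definition _ := GRing.Zmodule_isNzRing.Build endo
  endo_mulA endo_mul1 endo_mulr1 endo_mulDl endo_mulDr endo_id_neq0.

Lemma endoD (f g : endo) x : (f + g) x = f x + g x. Proof. by []. Qed.
Lemma endoM (f g : endo) x : (f * g) x = f (g x). Proof. by []. Qed.
Lemma endo1 x : (1 : endo) x = x. Proof. by []. Qed.
End Endomorphisms.

Section MonomialExtension.
Variables (k : nat) (R : nzRingType) (A : pzRingType).
Variables (kappa : {additive R -> A}) (w : 'X_{1..k} -> A).

(** Coefficients pass through [kappa], so that one extension serves for the normal forms, the action
    of [d i], [zeta] and [dil]. *)
Definition mono_ext (p : {mpoly R[k]}) : A :=
  \sum_(m <- msupp p) kappa p@_m * w m.

(** With a common list containing several supports, additivity becomes a termwise identity. *)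
Lemma mono_extE (s : seq 'X_{1..k}) p : uniq s -> {subset msupp p <= s} ->
  mono_ext p = \sum_(m <- s) kappa p@_m * w m.
Proof.
move=> us sub; rewrite /mono_ext [RHS](bigID (mem (msupp p))) /=.
rewrite [X in _ + X]big1 ?addr0; last first.
  by move=> m /memN_msupp_eq0 ->; rewrite raddf0 mul0r.
rewrite -[RHS]big_filter; apply/perm_big/uniq_perm => //.
- exact: filter_uniq.
- move=> m; rewrite mem_filter.
  by apply/idP/andP => [h|[]//]; split=> //; apply: sub.
Qed.

Lemma mono_ext_zmod : zmod_morphism mono_ext.
Proof.
move=> p q; pose s := undup (msupp p ++ msupp q).
have us : uniq s by rewrite undup_uniq.
have sp : {subset msupp p <= s} by move=> m; rewrite mem_undup mem_cat => ->.
have sq : {subset msupp q <= s}.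
  by move=> m mq; rewrite mem_undup mem_cat mq orbT.
have spq : {subset msupp (p - q) <= s}.
  by move=> m /msuppB_le; rewrite mem_undup.
rewrite (mono_extE us sp) (mono_extE us sq) (mono_extE us spq) -sumrB.
by apply: eq_bigr => m _; rewrite mcoeffB raddfB mulrBl.
Qed.
HB.instance Definition _ := GRing.isZmodMorphism.Build {mpoly R[k]} A
  mono_ext mono_ext_zmod.

Lemma mono_extZX c m : mono_ext (c *: 'X_[m]) = kappa c * w m.
Proof.
rewrite (@mono_extE [:: m]) ?big_seq1 ?mcoeffZ ?mcoeffX ?eqxx ?mulr1//.
by move=> m' /msuppZ_le; rewrite msuppX.
Qed.
End MonomialExtension.

Section MonomialExtensionScale.
Variables (k : nat) (R : nzRingType) (A : pzRingType).
Variables (kappa : {rmorphism R -> A}) (w : 'X_{1..k} -> A).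

Lemma mono_extX m : mono_ext kappa w 'X_[m] = w m.
Proof. by rewrite -['X_[m]]scale1r mono_extZX/= rmorph1 mul1r. Qed.

Lemma mono_extZ c p : mono_ext kappa w (c *: p) = kappa c * mono_ext kappa w p.
Proof.
elim/mpolyind: p => [|c' m p _ _ IH]; first by rewrite scaler0 !raddf0 mulr0.
rewrite scalerDr !raddfD/= IH mulrDr; congr (_ + _).
by rewrite scalerA !mono_extZX/= rmorphM mulrA.
Qed.
End MonomialExtensionScale.

Lemma endo_mpolyP (k : nat) (R : nzRingType) (f g : endo {mpoly R[k]}) :
  (forall c m, f (c *: 'X_[m]) = g (c *: 'X_[m])) -> f = g.
Proof.
move=> fg; apply: endoP; elim/mpolyind => [|c m p _ _ IH].
  by rewrite !raddf0.
by rewrite !raddfD/= IH fg.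
Qed.

Lemma fraction_numden (Z : idomainType) (f : {fraction Z}) :
  f = tofrac (repr f).1 / tofrac (repr f).2.
Proof.
have d0 := denom_ratioP (repr f).
apply: (canRL (mulfK _)); first by rewrite tofrac_eq0.
move: (repr f) (reprK f) d0 => x <- d0.
unlock FracField.tofrac; rewrite -[LHS]FracField.pi_mul.
apply/eqmodP; rewrite /= FracField.equivfE /FracField.mulf /=.
by rewrite !numden_Ratio ?mulf_neq0 ?oner_eq0 ?oner_neq0 ?d0 // !mulr1 mulrC.
Qed.

(** With more rows than columns, the matrix has a nonzero left kernel vector over the fraction
    field; clearing denominators brings it into [Z]. *)
Lemma idomain_kernel (Z : idomainType) (I J : finType) (G : I -> J -> Z) :
  (#|J| < #|I|)%N ->
  exists2 c : I -> Z, exists i, c i != 0 & forall j, \sum_i c i * G i j = 0.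
Proof.
move=> JI; pose M : 'M[{fraction Z}]_(#|I|, #|J|) :=
  \matrix_(i, j) tofrac (G (enum_val i) (enum_val j)).
have : kermx M != 0.
  rewrite kermx_eq0 /row_free; apply: contraTneq (rank_leq_col M) => ->.
  by rewrite -ltnNge.
move=> /rowV0Pn[v /sub_kermxP vM v0].
have [D D0 [c cE]] : exists2 D : Z, D != 0 &
    exists c : I -> Z, forall i, tofrac (c i) = tofrac D * v 0 (enum_rank i).
  pose r i := repr (v 0 (enum_rank i) : {fraction Z}).
  have rE i : v 0 (enum_rank i) = tofrac (r i).1 / tofrac (r i).2.
    by rewrite -fraction_numden.
  (* [D] is the product of all denominators; entry [i] scaled by it is its numerator times the other
     denominators. *)
  exists (\prod_i (r i).2).
    by apply/prodf_neq0 => i _; apply: denom_ratioP.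
  exists (fun i => (r i).1 * \prod_(j | j != i) (r j).2) => i.
  rewrite [X in tofrac X * _](bigD1 i)//= rE !rmorphM/=.
  rewrite [RHS]mulrAC [tofrac (r i).2 * _]mulrC.
  by rewrite divfK// tofrac_eq0 denom_ratioP.
exists c => [|j].
  have /rV0Pn[i vi] := v0; exists (enum_val i).
  by rewrite -tofrac_eq0 cE enum_valK mulf_neq0 // tofrac_eq0.
apply/eqP; rewrite -tofrac_eq0 rmorph_sum/=; apply/eqP.
have /rowP/(_ (enum_rank j)) := vM; rewrite !mxE => vM0.
transitivity (tofrac D * \sum_i v 0 i * M i (enum_rank j)); last first.
  by rewrite vM0 mulr0.
rewrite mulr_sumr [RHS](reindex enum_rank)/=; last exact/onW_bij/enum_rank_bij.
by apply: eq_bigr => i _; rewrite rmorphM/= cE !mxE !enum_rankK mulrA.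
Qed.

(** * Normal forms in a Weyl system *)

Section CommutingProducts.
Variable A : pzRingType.

Lemma prodrM_comm (I : Type) (s : seq I) (f g : I -> A) :
  (forall i j, GRing.comm (f i) (g j)) ->
  \prod_(i <- s) f i * \prod_(i <- s) g i = \prod_(i <- s) (f i * g i).
Proof.
move=> fg; elim: s => [|i s IH]; first by rewrite !big_nil mulr1.
rewrite !big_cons -IH -!mulrA; congr (_ * _); rewrite !mulrA; congr (_ * _).
by apply/commr_sym/commr_prod => j _; apply/commr_sym.
Qed.

Variables (n : nat) (f : 'I_n -> A).
Hypothesis fC : forall i j, GRing.comm (f i) (f j).

Lemma prodrXD_comm (a b : 'I_n -> nat) :
  \prod_i f i ^+ a i * \prod_i f i ^+ b i = \prod_i f i ^+ (a i + b i).
Proof.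
rewrite prodrM_comm => [|i j]; last exact/commrX/commr_sym/commrX/commr_sym.
by apply: eq_bigr => i _; rewrite exprD.
Qed.

(** The factor [(j != i)] removes index [i] while keeping the full index range, so that
    [prodrXD_comm] still applies. *)
Lemma prodrX_split i (a : 'I_n -> nat) :
  \prod_j f j ^+ a j = f i ^+ a i * \prod_j f j ^+ (a j * (j != i)).
Proof.
have -> : f i ^+ a i = \prod_j f j ^+ (a j * (j == i)).
  rewrite -[LHS](big_pred1_eq *%R i (fun j => f j ^+ a j)) big_mkcond/=.
  by apply: eq_bigr => j _; case: (j == i); rewrite ?muln1 ?muln0.
rewrite prodrXD_comm; apply: eq_bigr => j _.
by case: (j == i); rewrite ?muln1 ?muln0 ?addn0.
Qed.

Lemma mul_prodrX i (a : 'I_n -> nat) :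
  f i * \prod_j f j ^+ a j = \prod_j f j ^+ (a j + (i == j)).
Proof.
rewrite [RHS](prodrX_split i) [in LHS](prodrX_split i) eqxx addn1 exprS mulrA.
congr (_ * _); apply: eq_bigr => j _; rewrite eq_sym.
by case: (i == j); rewrite ?muln0 ?addn0.
Qed.
End CommutingProducts.

Lemma prim_root_neq0 (F : fieldType) l (q : F) : l.-primitive_root q -> q != 0.
Proof.
move=> ql; apply/eqP => q0; have := prim_expr_order ql.
rewrite q0 expr0n (gtn_eqF (prim_order_gt0 ql)) => /eqP.
by rewrite eq_sym oner_eq0.
Qed.

Section QInt.
Variables (R : comNzRingType) (t : R).

(** The [t]-analogue of the integer [k], which appears when [d i] moves past [x i ^+ k]. *)
Definition qint (k : nat) : R := \sum_(i < k) t ^+ i.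

Lemma qint0 : qint 0 = 0. Proof. by rewrite /qint big_ord0. Qed.

Lemma qintS k : qint k.+1 = t * qint k + 1.
Proof.
rewrite /qint big_ord_recl expr0 addrC mulr_sumr; congr (_ + _).
by apply: eq_bigr => i _; rewrite exprS.
Qed.

End QInt.

(** Stated for arbitrary elements of a ring, so as to cover the generators of the generic algebra,
    those of its specializations, and their images under an endomorphism. *)
Definition weyl_system (R : comNzRingType) (t : R) (n : nat) (A : pzRingType)
    (kappa : R -> A) (x d : 'I_n -> A) : Prop :=
  [/\ forall c a, GRing.comm (kappa c) a,
      forall i j, d i * x j = kappa (t ^+ (i == j)) * (x j * d i) + (i == j)%:R,
      forall i j, GRing.comm (x i) (x j)
    & forall i j, GRing.comm (d i) (d j)].

Section NormalForm.
Variables (R : comNzRingType) (t : R) (n : nat) (A : pzRingType).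
Variables (kappa : {rmorphism R -> A}) (x d : 'I_n -> A).
Hypothesis sys : weyl_system t kappa x d.

Definition weyl_mon (m : 'X_{1..n + n}) : A :=
  \prod_i x i ^+ m (lshift n i) * \prod_i d i ^+ m (rshift n i).

(** Here [{mpoly R[n + n]}] is only the free module on the exponents; its product is not that of
    [A]. *)
Definition weyl_nf : {mpoly R[n + n]} -> A := mono_ext kappa weyl_mon.
HB.instance Definition _ :=
  GRing.Additive.copy weyl_nf (mono_ext kappa weyl_mon).

Let kC c a : GRing.comm (kappa c) a. Proof. by case: sys. Qed.
Let dx i j : d i * x j = kappa (t ^+ (i == j)) * (x j * d i) + (i == j)%:R.
Proof. by case: sys. Qed.
Let xC i j : GRing.comm (x i) (x j). Proof. by case: sys. Qed.
Let dC i j : GRing.comm (d i) (d j). Proof. by case: sys. Qed.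

Lemma weyl_comm i j : i != j -> GRing.comm (d i) (x j).
Proof.
by move=> /negbTE ij; rewrite /GRing.comm dx ij expr0 rmorph1 mul1r addr0.
Qed.

Lemma weyl_d_xX i k :
  d i * x i ^+ k =
    kappa (t ^+ k) * (x i ^+ k * d i) + kappa (qint t k) * x i ^+ k.-1.
Proof.
elim: k => [|k IH].
  by rewrite !expr0 qint0 rmorph0 rmorph1 mul0r addr0 mulr1 !mul1r.
rewrite exprSr mulrA IH mulrDl -!mulrA dx eqxx expr1 mulrDr mulr1.
rewrite /= [X in _ + X](_ : _ = kappa (qint t k) * x i ^+ k); last first.
  (* At [k = 0] the truncation in [k.-1] is harmless, since [qint t 0] vanishes. *)
  by case: k {IH} => [|k] /=; rewrite ?qint0 ?rmorph0 ?mul0r // exprSr.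
rewrite mulrDr exprSr [x i ^+ k * (_ * _)]mulrA -(kC t) !mulrA -rmorphM -exprSr.
rewrite -addrA -mulrDl -rmorphD; congr (_ + kappa _ * _).
rewrite /qint big_ord_recr/= addrC//.
Qed.

Lemma weyl_dX_x i k :
  d i ^+ k * x i =
    kappa (t ^+ k) * (x i * d i ^+ k) + kappa (qint t k) * d i ^+ k.-1.
Proof.
elim: k => [|k IH].
  by rewrite !expr0 qint0 rmorph0 rmorph1 mul0r addr0 mulr1 !mul1r.
rewrite exprS -mulrA IH mulrDr !mulrA -!(kC _ (d i)) -!mulrA.
rewrite [d i * (x i * _)]mulrA.
rewrite dx eqxx expr1 mulrDl mul1r mulrDr.
rewrite -addrA [X in _ + (_ + X)](_ : _ = kappa (qint t k) * d i ^+ k);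
  last first.
  by case: k {IH} => [|k] /=; rewrite ?qint0 ?rmorph0 ?mul0r // exprS.
rewrite -mulrDl -rmorphD !mulrA -rmorphM -exprSr -!mulrA -exprS.
congr (_ + kappa _ * _).
rewrite /qint big_ord_recr/= addrC//.
Qed.

Lemma weyl_x_mon i m : x i * weyl_mon m = weyl_mon (U_(lshift n i) + m).
Proof.
rewrite mulrA mul_prodrX//; congr (_ * _); apply: eq_bigr => j _.
  by rewrite mnmDE mnm1E addnC (inj_eq (@lshift_inj _ _)).
by rewrite mnmDE mnm1E eq_lrshift.
Qed.

(** [d i] commutes with [x j] for [j != i], so only the power of [x i] contributes, through
    [weyl_d_xX]. If its exponent is 0, the truncated [m - U_(lshift n i)] has coefficient 0. *)
Lemma weyl_d_mon i m : d i * weyl_mon m =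
  kappa (t ^+ m (lshift n i)) * weyl_mon (m + U_(rshift n i))
  + kappa (qint t (m (lshift n i))) * weyl_mon (m - U_(lshift n i)).
Proof.
rewrite /weyl_mon; set D := \prod_j d j ^+ m (rshift n j).
set k := m (lshift n i).
pose P := \prod_j x j ^+ (m (lshift n j) * (j != i)).
have PC : GRing.comm (d i) P.
  apply: commr_prod => j _; have [->|ji] := eqVneq j i.
    by rewrite muln0 expr0; apply: commr1.
  by apply/commrX/weyl_comm; rewrite eq_sym.
have -> : \prod_j d j ^+ (m + U_(rshift n i))%MM (rshift n j) = d i * D.
  rewrite mul_prodrX//; apply: eq_bigr => j _.
  by rewrite mnmDE mnm1E (inj_eq (@rshift_inj _ _)).
have -> : \prod_j x j ^+ (m + U_(rshift n i))%MM (lshift n j) = x i ^+ k * P.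
  rewrite (prodrX_split xC i) mnmDE mnm1E eq_rlshift addn0; congr (_ * _).
  by apply: eq_bigr => j _; rewrite mnmDE mnm1E eq_rlshift addn0.
have -> : \prod_j d j ^+ (m - U_(lshift n i))%MM (rshift n j) = D.
  by apply: eq_bigr => j _; rewrite mnmBE mnm1E eq_lrshift subn0.
have -> : \prod_j x j ^+ (m - U_(lshift n i))%MM (lshift n j) = x i ^+ k.-1 * P.
  rewrite (prodrX_split xC i) mnmBE mnm1E eqxx subn1; congr (_ * _).
  apply: eq_bigr => j _; rewrite mnmBE mnm1E (inj_eq (@lshift_inj _ _)) eq_sym.
  by case: (j == i); rewrite ?muln0 ?subn0.
rewrite (prodrX_split xC i) !mulrA weyl_d_xX !mulrDl -!mulrA.
by rewrite [d i * (P * _)]mulrA PC -!mulrA.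
Qed.

(* The action of [d i] on the normal forms [x^a d^b] by left multiplication. *)
Definition op_d (i : 'I_n) : {mpoly R[n + n]} -> {mpoly R[n + n]} :=
  mono_ext (@mpolyC (n + n) R) (fun m =>
    t ^+ m (lshift n i) *: 'X_[m + U_(rshift n i)]
    + qint t (m (lshift n i)) *: 'X_[m - U_(lshift n i)]).
HB.instance Definition _ i := GRing.Additive.copy (op_d i)
  (mono_ext (@mpolyC (n + n) R) (fun m =>
    t ^+ m (lshift n i) *: 'X_[m + U_(rshift n i)]
    + qint t (m (lshift n i)) *: 'X_[m - U_(lshift n i)])).

Lemma weyl_nfX m : weyl_nf 'X_[m] = weyl_mon m.
Proof. exact: mono_extX. Qed.

Lemma weyl_nfZ c p : weyl_nf (c *: p) = kappa c * weyl_nf p.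
Proof. exact: mono_extZ. Qed.

Lemma op_dX i m : op_d i 'X_[m] = t ^+ m (lshift n i) *: 'X_[m + U_(rshift n i)]
    + qint t (m (lshift n i)) *: 'X_[m - U_(lshift n i)].
Proof. exact: mono_extX. Qed.

Lemma op_dZ i c p : op_d i (c *: p) = c *: op_d i p.
Proof. by rewrite /op_d mono_extZ mul_mpolyC. Qed.

Lemma weyl_nf_x i p : weyl_nf ('X_(lshift n i) * p) = x i * weyl_nf p.
Proof.
elim/mpolyind: p => [|c m p _ _ IH]; first by rewrite mulr0 raddf0 mulr0.
rewrite mulrDr !raddfD mulrDr/= IH; congr (_ + _).
by rewrite -scalerAr !weyl_nfZ -mpolyXD !weyl_nfX -weyl_x_mon !mulrA kC.
Qed.

Lemma weyl_nf_d i p : weyl_nf (op_d i p) = d i * weyl_nf p.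
Proof.
elim/mpolyind: p => [|c m p _ _ IH]; first by rewrite !raddf0 mulr0.
rewrite !raddfD mulrDr/= IH; congr (_ + _).
rewrite op_dZ !weyl_nfZ mulrA -(kC c (d i)) -mulrA; congr (_ * _).
by rewrite op_dX raddfD/= !weyl_nfZ !weyl_nfX weyl_d_mon.
Qed.

Lemma weyl_nf1 : weyl_nf 1 = 1.
Proof.
rewrite -mpolyX0 weyl_nfX /weyl_mon !big1 ?mulr1// => i _;
  by rewrite mnm0E expr0.
Qed.

(** Generation is encoded as an induction in which products grow only on the left, matching the left
    action on normal forms. *)
Definition weyl_generated : Prop := forall P : A -> Prop,
  P 1 -> (forall a b, P a -> P b -> P (a + b)) ->
  (forall c a, P a -> P (kappa c * a)) ->
  (forall i a, P a -> P (x i * a)) -> (forall i a, P a -> P (d i * a)) ->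
  forall a, P a.

Lemma weyl_nf_surj : weyl_generated -> forall a, exists p, weyl_nf p = a.
Proof.
apply.
- by exists 1; apply: weyl_nf1.
- by move=> _ _ [p <-] [q <-]; exists (p + q); rewrite raddfD.
- by move=> c _ [p <-]; exists (c *: p); rewrite weyl_nfZ.
- by move=> i _ [p <-]; exists ('X_(lshift n i) * p); rewrite weyl_nf_x.
- by move=> i _ [p <-]; exists (op_d i p); rewrite weyl_nf_d.
Qed.
End NormalForm.

(** * The action on polynomials *)

Section Operators.
Variables (R : comNzRingType) (t : R) (n : nat).
Local Notation P := {mpoly R[n + n]}.

Fact endo_scale_subproof (c : R) : zmod_morphism (fun p : P => c *: p).
Proof. by move=> p q; rewrite scalerBr. Qed.
Definition endo_scale c : endo P := Endo (endo_scale_subproof c).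

Fact endo_scale_zmod : zmod_morphism endo_scale.
Proof. by move=> c c'; apply: endoP => p /=; rewrite scalerBl. Qed.
Fact endo_scale_monoid : monoid_morphism endo_scale.
Proof.
split=> [|c c']; first by apply: endoP => p /=; rewrite scale1r.
by apply: endoP => p /=; rewrite scalerA.
Qed.
HB.instance Definition _ :=
  GRing.isZmodMorphism.Build R (endo P) endo_scale endo_scale_zmod.
HB.instance Definition _ :=
  GRing.isMonoidMorphism.Build R (endo P) endo_scale endo_scale_monoid.

Fact endo_x_subproof i : zmod_morphism (fun p : P => 'X_(lshift n i) * p).
Proof. by move=> p q; rewrite mulrBr. Qed.
Definition endo_x i : endo P := Endo (endo_x_subproof i).

Definition endo_d i : endo P :=
  @Endo _ (op_d t i) (raddfB (op_d t i : {additive P -> P})).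

Lemma endo_xX i m : endo_x i 'X_[m] = 'X_[U_(lshift n i) + m].
Proof. by rewrite /= mpolyXD. Qed.

Lemma endo_xZ i c p : endo_x i (c *: p) = c *: endo_x i p.
Proof. by rewrite /= scalerAr. Qed.

Lemma endo_dD i p q : endo_d i (p + q) = endo_d i p + endo_d i q.
Proof. exact: raddfD. Qed.

Lemma endo_dX i m : endo_d i 'X_[m] =
  t ^+ m (lshift n i) *: 'X_[m + U_(rshift n i)]
    + qint t (m (lshift n i)) *: 'X_[m - U_(lshift n i)].
Proof. exact: op_dX. Qed.

Lemma endo_dZ i c p : endo_d i (c *: p) = c *: endo_d i p.
Proof. exact: op_dZ. Qed.

Lemma endo_scale_x c i : GRing.comm (endo_scale c) (endo_x i).
Proof. by apply: endoP => p; rewrite !endoM endo_xZ. Qed.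

Lemma endo_scale_d c i : GRing.comm (endo_scale c) (endo_d i).
Proof. by apply: endoP => p; rewrite !endoM endo_dZ. Qed.

Lemma endo_x_comm i j : GRing.comm (endo_x i) (endo_x j).
Proof. by apply: endoP => p; rewrite !endoM /= mulrCA. Qed.

(** Checked on monomials: for [i != j] the first-block exponents concerned are distinct, and for
    [i = j] the identity is the recurrence [qintS]. *)
Lemma endo_dx i j : endo_d i * endo_x j =
  endo_scale (t ^+ (i == j)) * (endo_x j * endo_d i) + (i == j)%:R.
Proof.
apply: endo_mpolyP => c m; rewrite endoD !endoM !(endo_xZ, endo_dZ).
have -> : ((i == j)%:R : endo P) (c *: 'X_[m]) = c *: ((i == j)%:R *: 'X_[m]).
  by case: (i == j); rewrite ?endo1 ?scale1r // scale0r scaler0.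
rewrite endo_xX !endo_dX [endo_x j _]raddfD/= -!scalerAr -!mpolyXD.
rewrite [X in _ = X + _]scalerA [_ * c]mulrC -scalerA -scalerDr; congr (_ *: _).
rewrite scalerDr !scalerA -exprD mnmDE mnm1E (inj_eq (@lshift_inj _ _)).
rewrite [j == i]eq_sym -addrA addmA; congr (_ + _).
have [<-{j}|ij] := eqVneq i j; last first.
  rewrite scale0r addr0 mul1r add0n; congr (_ *: 'X_[_]).
  apply/mnmP => k; rewrite !(mnmDE, mnmBE, mnm1E).
  have [<-|] := eqVneq (lshift n j) k; last by rewrite !add0n.
  by rewrite (inj_eq (@lshift_inj _ _)) (negbTE ij) !subn0.
rewrite expr1 add1n qintS scale1r addmC addmK.
rewrite scalerDl scale1r; congr (_ + _).
(* The subtraction of [U_(lshift n i)] truncates only when this exponent is 0, and then its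
   coefficient vanishes. *)
case: (posnP (m (lshift n i))) => [->|m0].
  by rewrite qint0 mulr0 !scale0r.
by rewrite addmC submK// lep1mP -lt0n.
Qed.

(** For [i != j] both composites give the same four terms: raising an exponent of the second block
    and lowering one of the first act at different positions. *)
Lemma endo_d_comm i j : GRing.comm (endo_d i) (endo_d j).
Proof.
have [->//|ij] := eqVneq i j.
apply: endo_mpolyP => c m; rewrite !endoM !endo_dZ; congr (_ *: _).
rewrite !endo_dX !endo_dD !endo_dZ !endo_dX !scalerDr !scalerA.
rewrite !(mnmBE, mnmDE, mnm1E) !(inj_eq (@lshift_inj _ _)) !eq_rlshift.
rewrite [j == i]eq_sym (negbTE ij) !subn0 !addn0.
have sw k l : (m + U_(rshift n k) - U_(lshift n l) =
    m - U_(lshift n l) + U_(rshift n k))%MM.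
  apply/mnmP => h; rewrite !(mnmBE, mnmDE, mnm1E).
  have [<-|_] := eqVneq (lshift n l) h; last by rewrite !subn0.
  by rewrite eq_rlshift !addn0.
rewrite !sw -!addmA [(U_(rshift n i) + _)%MM]addmC !submDA.
rewrite [(U_(lshift n i) + _)%MM]addmC.
set a := _ *: _; set b := _ *: _; set e := _ *: _; set f := _ *: _.
rewrite addrACA; congr (_ + _ + (_ + _)).
all: rewrite mulrC//.
Qed.
End Operators.

(** * Leading monomials and faithfulness of the action *)

Section LeadingMonomials.
Variables (F : fieldType) (k : nat).
Local Notation P := {mpoly F[k]}.

(** The nonvanishing clause makes the condition stable under composition and gives additive
    operators a trivial kernel. *)
Definition shifts_lead (T : P -> P) (e : 'X_{1..k}) : Prop :=
  forall p, p != 0 -> T p != 0 /\ mlead (T p) = (mlead p + e)%MM.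

(** Translation by [e] preserves the strict order, so by induction on the leading monomial the image
    of the lower terms stays below that of the leading term and cannot cancel it. *)
Lemma shifts_lead_mono (T : endo P) e :
  (forall c m, c != 0 ->
     T (c *: 'X_[m]) != 0 /\ mlead (T (c *: 'X_[m])) = (m + e)%MM) ->
  shifts_lead T e.
Proof.
move=> TX; elim/mleadrect => p IH p0.
set l := mlead p; set c := p@_l; have c0 : c != 0 by rewrite mleadc_eq0.
pose r := p - c *: 'X_[l].
have pE : p = c *: 'X_[l] + r by rewrite addrC subrK.
have [Tl Tlm] := TX c l c0.
have [r0|r0] := eqVneq r 0; first by rewrite {1 2}pE r0 addr0.
have rl : (mlead r < l)%O.
  have := mlead_supp r0; rewrite (perm_mem (msupp_rem p l)) mem_rem_uniq//.
  by rewrite inE => /andP[lr /msupp_le_mlead rp]; rewrite lt_neqAle lr.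
have [Tr Trm] := IH r rl r0.
have lt : (mlead (T r) < mlead (T (c *: 'X_[l])))%O.
  by rewrite Trm Tlm ltmc_add2l.
rewrite {1 2}pE raddfD; split; last by rewrite mleadDl.
apply/eqP => /eqP; rewrite addr_eq0 => /eqP h.
by move: lt; rewrite h mleadN ltxx.
Qed.

Lemma shifts_lead_id : shifts_lead id 0%MM.
Proof. by move=> p p0; rewrite addm0. Qed.

Lemma shifts_lead_mul (f g : endo P) a b :
  shifts_lead f a -> shifts_lead g b -> shifts_lead (f * g : endo P) (a + b)%MM.
Proof.
move=> fa gb p /gb[/fa[fg0 fgE] gE]; split=> //.
by rewrite fgE gE -addmA [(b + a)%MM]addmC.
Qed.

Lemma shifts_lead_prodX (n : nat) (f : 'I_n -> endo P) e (a : 'I_n -> nat) :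
  (forall i, shifts_lead (f i) (e i)) ->
  shifts_lead (\prod_i f i ^+ a i : endo P) (\sum_i e i *+ a i)%MM.
Proof.
move=> fe; elim/big_rec2: _ => [|i s g _ gs]; first exact: shifts_lead_id.
apply: shifts_lead_mul => //; elim: (a i) => [|j IH].
  by rewrite mulm0n expr0; apply: shifts_lead_id.
by rewrite mulmS exprS; apply: shifts_lead_mul.
Qed.
End LeadingMonomials.

Section Faithful.
Variables (F : fieldType) (q : F) (n : nat).
Hypothesis q0 : q != 0.
Local Notation P := {mpoly F[n + n]}.

Lemma endo_x_shift i : shifts_lead (endo_x F i) U_(lshift n i)%MM.
Proof.
move=> p p0; have X0 : 'X_(lshift n i) != 0 :> P.
  by rewrite -msupp_eq0 msuppX.
by rewrite /= mulf_neq0 // mleadM // mleadXm addmC.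
Qed.

(** The degree-raising term has a power of [q] as coefficient, which is nonzero, and it dominates
    the other term because the order compares degrees first. *)
Lemma endo_d_shift i : shifts_lead (endo_d q i) U_(rshift n i)%MM.
Proof.
apply: shifts_lead_mono => c m c0; rewrite endo_dZ endo_dX.
set a := _ *: 'X_[_]; set b := _ *: 'X_[_].
have am : mlead a = (m + U_(rshift n i))%MM.
  by rewrite mleadZ ?mleadXm // expf_neq0.
have a0 : a != 0.
  by rewrite scaler_eq0 expf_eq0 (negbTE q0) andbF -msupp_eq0 msuppX.
have ba : (mlead b < mlead a)%O.
  rewrite am; apply: le_lt_trans (mleadZ_le _ _) _; rewrite mleadXm.
  apply: (@le_lt_trans _ _ m); first exact/lem_leo/lem_subr.
  by apply: lt_mdeg_ltmc; rewrite mdegD mdeg1 addn1.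
have ab : a + b != 0.
  apply/eqP => /eqP; rewrite addr_eq0 => /eqP h.
  by move: ba; rewrite h mleadN ltxx.
by rewrite scaler_eq0 negb_or c0 ab mleadZ // mleadDl.
Qed.

Variables (A : pzRingType) (kappa : {rmorphism F -> A}) (x d : 'I_n -> A).
Variable rho : {rmorphism A -> endo P}.
Hypothesis rhok : forall c, rho (kappa c) = endo_scale n c.
Hypothesis rhox : forall i, rho (x i) = endo_x F i.
Hypothesis rhod : forall i, rho (d i) = endo_d q i.

Lemma rho_mon_shift m : shifts_lead (rho (weyl_mon x d m)) m.
Proof.
rewrite rmorphM !rmorph_prod /=.
have -> : \prod_i rho (x i ^+ m (lshift n i)) =
    \prod_i endo_x F i ^+ m (lshift n i).
  by apply: eq_bigr => i _; rewrite rmorphXn /= rhox.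
have -> : \prod_i rho (d i ^+ m (rshift n i)) =
    \prod_i endo_d q i ^+ m (rshift n i).
  by apply: eq_bigr => i _; rewrite rmorphXn /= rhod.
rewrite [X in shifts_lead _ X]multinomUE_id big_split_ord /=.
apply: shifts_lead_mul; apply: shifts_lead_prodX => i.
  exact: endo_x_shift.
exact: endo_d_shift.
Qed.

(** For fixed [r], the map from [p] to this value shifts leading monomials by [mlead r], since each
    monomial acts as a shift. Acting on 1 gives independence of the normal forms; acting twice
    excludes zero divisors. *)
Lemma weyl_nf_act_neq0 p r : p != 0 -> r != 0 ->
  rho (weyl_nf kappa x d p) r != 0.
Proof.
move=> p0 r0.
have TB : zmod_morphism (fun p => rho (weyl_nf kappa x d p) r).
  by move=> a b; rewrite !raddfB.
pose T := Endo TB.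
suff : shifts_lead T (mlead r) by move=> /(_ p p0)[].
apply: shifts_lead_mono => c m c0 /=.
rewrite weyl_nfZ weyl_nfX rmorphM /= rhok.
have [m0 mE] := rho_mon_shift m r0.
by rewrite scaler_eq0 negb_or c0 m0 mleadZ // mE addmC.
Qed.

Lemma weyl_nf_inj : injective (weyl_nf kappa x d).
Proof.
move=> p r pr; apply/eqP; rewrite -subr_eq0; apply/negP => /negP pr0.
have := weyl_nf_act_neq0 pr0 (oner_neq0 _).
by rewrite raddfB /= pr subrr raddf0 eqxx.
Qed.

Hypothesis nf_surj : forall a, exists p, weyl_nf kappa x d p = a.

Lemma weyl_domain (a b : A) : a * b = 0 -> a = 0 \/ b = 0.
Proof.
case: (nf_surj a) => p <-; case: (nf_surj b) => r <- ab.
have [->|p0] := eqVneq p 0; first by left; rewrite raddf0.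
have [->|r0] := eqVneq r 0; first by right; rewrite raddf0.
have one0 : (1 : P) != 0 by exact: oner_neq0.
have := weyl_nf_act_neq0 p0 (weyl_nf_act_neq0 r0 one0).
by rewrite -endoM -rmorphM /= ab rmorph0 eqxx.
Qed.
End Faithful.

(** * Monomials in the generators at a root of unity *)

Section QuasiCommutation.
Variables (R : comNzRingType) (A : pzRingType) (kappa : {rmorphism R -> A}).
Hypothesis kC : forall c a, GRing.comm (kappa c) a.

Definition qcomm (c : R) (a b : A) : Prop := a * b = kappa c * (b * a).

Lemma qcomm1 a b : GRing.comm a b <-> qcomm 1 a b.
Proof. by rewrite /qcomm rmorph1 mul1r. Qed.

Lemma qcommM c c' a b b' :
  qcomm c a b -> qcomm c' a b' -> qcomm (c * c') a (b * b').
Proof.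
rewrite /qcomm => ab ab'; rewrite mulrA ab -!mulrA ab' !mulrA.
by rewrite -[_ * b * kappa c']mulrA -(kC c' b) !mulrA -rmorphM.
Qed.

Lemma qcommX c a b k : qcomm c a b -> qcomm (c ^+ k) a (b ^+ k).
Proof.
move=> ab; elim: k => [|k IH]; last by rewrite !exprS; apply: qcommM.
by rewrite !expr0; apply/qcomm1; apply: commr1.
Qed.

Lemma qcomm_prod n a (c : 'I_n -> R) (b : 'I_n -> A) (e : 'I_n -> nat) :
  (forall i, qcomm (c i) a (b i)) ->
  qcomm (\prod_i c i ^+ e i) a (\prod_i b i ^+ e i).
Proof.
move=> ab; elim/big_rec2: _ => [|i s g _ gs]; first exact/qcomm1/commr1.
by apply: qcommM => //; apply: qcommX.
Qed.

Lemma qcomm_prod_eq n q a (b : 'I_n -> A) (e : 'I_n -> nat) i :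
  (forall j, qcomm (q ^+ (i == j)) a (b j)) ->
  qcomm (q ^+ e i) a (\prod_j b j ^+ e j).
Proof.
move=> ab; suff -> : q ^+ e i = \prod_j (q ^+ (i == j)) ^+ e j.
  exact: qcomm_prod.
rewrite (bigD1 i)//= eqxx expr1 big1 ?mulr1// => j ji.
by rewrite eq_sym (negbTE ji) expr0 expr1n.
Qed.
End QuasiCommutation.

Section WeylCommutators.
Variables (R : comNzRingType) (t : R) (n : nat) (A : pzRingType).
Variables (kappa : {rmorphism R -> A}) (x d : 'I_n -> A).
Hypothesis sys : weyl_system t kappa x d.

(** In a Weyl system this is [1 + (t - 1) x i d i]; unlike [d i], it commutes with every [x j] up to
    a power of [t]. *)
Definition weyl_u i : A := d i * x i - x i * d i.

Lemma weyl_u_x i j : qcomm kappa (t ^+ (i == j)) (weyl_u i) (x j).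
Proof.
have [kC dx xC dC] := sys; rewrite /qcomm /weyl_u.
have [<-{j}|ij] := eqVneq i j; last first.
  rewrite expr0 rmorph1 mul1r mulrBl mulrBr.
  have dxj := weyl_comm sys ij.
  congr (_ - _); first by rewrite -mulrA xC mulrA dxj -mulrA.
  by rewrite -mulrA dxj mulrA xC mulrA.
have dxi : d i * x i = kappa t * (x i * d i) + 1 by rewrite dx eqxx expr1.
have xdx : kappa t * (x i * (x i * d i)) = x i * (d i * x i) - x i.
  by rewrite dxi mulrDr mulr1 addrK mulrA kC -mulrA.
rewrite expr1 mulrBl mulrBr mulrBr xdx {1}dxi mulrDl mul1r -!mulrA.
by rewrite opprB addrA addrAC.
Qed.

Lemma weyl_u_comm i j : GRing.comm (weyl_u i) (weyl_u j).
Proof.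
have [kC dx xC dC] := sys; have [->//|ij] := eqVneq i j.
have ux : GRing.comm (weyl_u i) (x j).
  by have := weyl_u_x i j; rewrite (negbTE ij) => /qcomm1.
have ud : GRing.comm (weyl_u i) (d j).
  apply/commr_sym/commrB; apply: commrM => //;
    apply: (weyl_comm sys); by rewrite eq_sym.
by apply: commrB; apply: commrM.
Qed.
End WeylCommutators.

Section Eigenvectors.
Variables (F : fieldType) (A : pzRingType) (kappa : {rmorphism F -> A}).
Hypothesis kC : forall c a, GRing.comm (kappa c) a.
Hypothesis dom : forall a b : A, a * b = 0 -> a = 0 \/ b = 0.
Variables (J : finType) (K : Type) (z : K -> A) (lam : K -> J -> F).
Hypothesis z0 : forall k, z k <> 0.
Hypothesis lam_sep : forall i j, i != j -> exists k, lam k i != lam k j.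

(** The usual shortening: from the relation multiplied by [z k] on the left, subtract [lam k i]
    times the relation multiplied by [z k] on the right. This kills term [i] and scales term [j] by
    a nonzero factor; the right factor [z k] left over cancels in a domain. *)
Lemma eigenvectors_sum_eq0 (S : {set J}) (w : J -> A) :
  (forall k j, qcomm kappa (lam k j) (z k) (w j)) ->
  \sum_(j in S) w j = 0 -> forall j, j \in S -> w j = 0.
Proof.
have [m] := ubnP #|S|; elim: m => // m IH in S w *.
rewrite ltnS => Sm zw sw j jS.
have [[i /andP[iS ij]]|no] := pselect (exists i, (i \in S) && (i != j));
  last first.
  rewrite -sw (bigD1 j)//= big1 ?addr0// => i /andP[iS ij].
  by case: no; exists i; rewrite iS.
have [k kij] := lam_sep ij.
pose w' h := kappa (lam k h - lam k i) * w h.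
have w'j : w' j = 0.
  have Sm' : (#|S :\ i| < m)%N by move: Sm; rewrite (cardsD1 i) iS.
  have zw' k' h : qcomm kappa (lam k' h) (z k') (w' h).
    rewrite /qcomm /w' mulrA -kC -mulrA zw !mulrA.
    by rewrite -[kappa _ * kappa _]kC.
  apply: (IH _ _ Sm' zw'); last by rewrite !inE eq_sym ij.
  suff /dom[//|/z0//] : (\sum_(h in S :\ i) w' h) * z k = 0.
  have -> : \sum_(h in S :\ i) w' h = \sum_(h in S) w' h.
    have w'i : w' i = 0 by rewrite /w' subrr rmorph0 mul0r.
    by rewrite (big_setD1 i iS)/= w'i add0r.
  transitivity (z k * (\sum_(h in S) w h)
      - kappa (lam k i) * ((\sum_(h in S) w h) * z k)); last first.
    by rewrite sw !(mulr0, mul0r) subrr.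
  rewrite !(mulr_sumr, mulr_suml) -sumrB; apply: eq_bigr => h _.
  by rewrite zw /w' rmorphB !mulrBl -!mulrA.
rewrite -[w j]mul1r -(rmorph1 kappa).
have l0 : lam k j - lam k i != 0 by rewrite subr_eq0 eq_sym.
by rewrite -(mulVf l0) rmorphM -mulrA [X in _ * X]w'j mulr0.
Qed.
End Eigenvectors.

(** * The central subring and the commutant at a root of unity *)

Section RootOfUnity.
Variables (F : fieldType) (q : F) (l : nat).
Hypothesis ql : l.-primitive_root q.
Hypothesis l1 : (1 < l)%N.
Variables (n : nat) (A : pzRingType) (kappa : {rmorphism F -> A}).
Variables (x d : 'I_n -> A).
Hypothesis sys : weyl_system q kappa x d.
Hypothesis gen : weyl_generated kappa x d.
Hypothesis nf_inj : injective (weyl_nf kappa x d).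
Hypothesis dom : forall a b : A, a * b = 0 -> a = 0 \/ b = 0.
Local Notation P := {mpoly F[n + n]}.
Local Notation mon := (weyl_mon x d).
Local Notation nf := (weyl_nf kappa x d).

Let kC c a : GRing.comm (kappa c) a. Proof. by case: sys. Qed.
Let xC i j : GRing.comm (x i) (x j). Proof. by case: sys. Qed.
Let dC i j : GRing.comm (d i) (d j). Proof. by case: sys. Qed.

Lemma weyl_central c : (forall i, GRing.comm c (x i)) ->
  (forall i, GRing.comm c (d i)) -> forall a, GRing.comm c a.
Proof.
move=> cx cd; apply: gen => [|a b|k a|i a|i a].
- exact: commr1.
- exact: commrD.
- by apply: commrM; apply/commr_sym.
- exact: commrM.
- exact: commrM.
Qed.

(** [(q - 1) * qint q l = q ^+ l - 1 = 0], while [q != 1] because [1 < l]. *)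
Lemma qint_order : qint q l = 0.
Proof.
have q1 : q - 1 != 0.
  rewrite subr_eq0 -(expr1 q) -(expr0 q) (eq_prim_root_expr ql).
  by rewrite mod0n modn_small.
by apply: (mulfI q1); rewrite mulr0 -subrX1 (prim_expr_order ql) subrr.
Qed.

(** With [q ^+ l = 1] and [qint q l = 0], the formula [weyl_d_xX] collapses to commutation with
    [d i]. *)
Lemma weyl_xl_central i a : GRing.comm (x i ^+ l) a.
Proof.
apply: weyl_central => j; first exact/commr_sym/commrX.
have [->|ji] := eqVneq i j; last first.
  by apply/commr_sym/commrX/(weyl_comm sys); rewrite eq_sym.
apply/commr_sym; rewrite /GRing.comm (weyl_d_xX sys).
rewrite (prim_expr_order ql) qint_order.
by rewrite rmorph0 rmorph1 mul0r addr0 mul1r.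
Qed.

Lemma weyl_dl_central i a : GRing.comm (d i ^+ l) a.
Proof.
apply: weyl_central => j; last exact/commr_sym/commrX.
have [->|ij] := eqVneq i j; last first.
  by apply/commr_sym/commrX/commr_sym/(weyl_comm sys).
rewrite /GRing.comm (weyl_dX_x sys) (prim_expr_order ql) qint_order.
by rewrite rmorph0 rmorph1 mul0r addr0 mul1r.
Qed.

Lemma weyl_mon_central m a : GRing.comm (mon (m *+ l)) a.
Proof.
apply/commr_sym/commrM; apply: commr_prod => i _.
  by rewrite mulmnE mulnC exprM; apply/commrX/commr_sym/weyl_xl_central.
by rewrite mulmnE mulnC exprM; apply/commrX/commr_sym/weyl_dl_central.
Qed.

(** The [d] part of the first monomial is central, so it moves past the [x] part of the second. *)
Lemma weyl_monD m m' : mon (m *+ l + m') = mon (m *+ l) * mon m'.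
Proof.
rewrite /weyl_mon.
set Dl := \prod_i d i ^+ (m *+ l)%MM (rshift n i).
have DlC a : GRing.comm Dl a.
  apply/commr_sym/commr_prod => i _.
  by rewrite mulmnE mulnC exprM; apply/commrX/commr_sym/weyl_dl_central.
rewrite -[RHS]mulrA [Dl * (_ * _)]mulrA DlC -!mulrA [RHS]mulrA.
rewrite !prodrXD_comm//; congr (_ * _);
  by apply: eq_bigr => i _; rewrite mnmDE.
Qed.

(* Identifies a polynomial ring with the central subring generated by the
   scalars and the [x i ^+ l], [d i ^+ l]. *)
Definition zeta : P -> A := mono_ext kappa (fun m => mon (m *+ l)).
HB.instance Definition _ :=
  GRing.Additive.copy zeta (mono_ext kappa (fun m => mon (m *+ l))).

Lemma zetaX m : zeta 'X_[m] = mon (m *+ l).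
Proof. exact: mono_extX. Qed.

Lemma zetaZ c p : zeta (c *: p) = kappa c * zeta p.
Proof. exact: mono_extZ. Qed.

Lemma zeta_central p a : GRing.comm (zeta p) a.
Proof.
elim/mpolyind: p => [|c m p _ _ IH].
  by rewrite raddf0; apply/commr_sym/commr0.
rewrite raddfD/= zetaZ zetaX; apply/commr_sym/commrD; last exact/commr_sym.
by apply: commrM; apply/commr_sym; [apply: kC|apply: weyl_mon_central].
Qed.

Lemma zetaM p r : zeta (p * r) = zeta p * zeta r.
Proof.
elim/mpolyind: p => [|c m p _ _ IH]; first by rewrite mul0r !raddf0 mul0r.
rewrite mulrDl !raddfD mulrDl/= IH; congr (_ + _).
rewrite -scalerAl !zetaZ -mulrA; congr (_ * _).
elim/mpolyind: r {IH} => [|c' m' r _ _ IH].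
  by rewrite mulr0 !raddf0 mulr0.
rewrite mulrDr !raddfD mulrDr/= IH; congr (_ + _).
rewrite -scalerAr !zetaZ -mpolyXD !zetaX mulrA -kC -mulrA; congr (_ * _).
rewrite -weyl_monD; congr (mon _).
by apply/mnmP => i; rewrite !(mulmnE, mnmDE) mulnDl.
Qed.

(** The substitution of [X_i ^+ l] for [X_i]; [zeta] is [nf] after [dil], which reduces its
    injectivity to that of [nf]. *)
Definition dil : P -> P :=
  mono_ext (@mpolyC (n + n) F) (fun m => 'X_[m *+ l]).
HB.instance Definition _ := GRing.Additive.copy dil
  (mono_ext (@mpolyC (n + n) F) (fun m => 'X_[m *+ l])).

Lemma zeta_inj p : zeta p = 0 -> p = 0.
Proof.
have dilX c m : dil (c *: 'X_[m]) = c *: 'X_[m *+ l].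
  by rewrite /dil mono_extZX mul_mpolyC.
have zE : zeta p = nf (dil p).
  elim/mpolyind: (p) => [|c m r _ _ IH]; first by rewrite !raddf0.
  by rewrite !raddfD/= IH dilX weyl_nfZ weyl_nfX zetaZ zetaX.
have coefE r m : (dil r)@_(m *+ l) = r@_m.
  elim/mpolyind: r => [|c m' r _ _ IH]; first by rewrite raddf0 !mcoeff0.
  rewrite raddfD/= !mcoeffD IH dilX !mcoeffZ !mcoeffX; congr (_ * _%:R + _).
  congr nat_of_bool; apply/eqP/eqP => [|->//] /mnmP h.
  apply/mnmP => i; have := h i; rewrite !mulmnE => /eqP.
  by rewrite eqn_pmul2r ?(ltnW l1)// => /eqP.
rewrite zE -(raddf0 nf) => /nf_inj dil0.
by apply/mpolyP => m; rewrite -coefE dil0 !mcoeff0.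
Qed.

Local Notation E := {ffun 'I_(n + n) -> 'I_l}.
Local Notation J := ({ffun 'I_n -> 'I_l} * {ffun 'I_n -> 'I_l})%type.

Definition expo (e : E) : 'X_{1..n + n} := [multinom (e i : nat) | i < n + n].

(** Euclidean division of the exponents by [l] splits a normal form into a central monomial and one
    with all exponents below [l]. *)
Lemma zeta_span a : exists g : E -> P, a = \sum_e zeta (g e) * mon (expo e).
Proof.
have [p <-] := weyl_nf_surj sys gen a.
elim/mpolyind: p => [|c m p _ _ [g IH]].
  by exists (fun=> 0); rewrite raddf0 big1// => e _; rewrite raddf0 mul0r.
have l0 : (0 < l)%N := ltnW l1.
pose e0 : E := [ffun i => Ordinal (ltn_pmod (m i) l0)].
pose m0 : 'X_{1..n + n} := [multinom (m i %/ l)%N | i < n + n].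
exists (fun e => (e == e0)%:R * (c *: 'X_[m0]) + g e).
rewrite raddfD/= IH.
transitivity (\sum_e (zeta ((e == e0)%:R * (c *: 'X_[m0])) * mon (expo e)
   + zeta (g e) * mon (expo e))); last first.
  by apply: eq_bigr => e _; rewrite raddfD mulrDl.
rewrite big_split/=; congr (_ + _).
rewrite (bigD1 e0)//= big1 ?addr0; last first.
  by move=> e /negbTE ->; rewrite mul0r raddf0 mul0r.
rewrite eqxx mul1r weyl_nfZ weyl_nfX zetaZ zetaX -mulrA -weyl_monD.
congr (_ * mon _); apply/mnmP => i.
by rewrite mnmDE mulmnE !mnmE ffunE /= -divn_eq.
Qed.

Variables (x' d' : 'I_n -> A).
Hypothesis sys' : weyl_system q kappa x' d'.
Local Notation u' := (weyl_u x' d').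
Hypothesis x'0 : forall i, x' i <> 0.
Hypothesis u'0 : forall i, u' i <> 0.

Definition xu_mon (j : J) : A :=
  \prod_i x' i ^+ j.1 i * \prod_i u' i ^+ j.2 i.

Definition xu_gen (k : 'I_n + 'I_n) : A :=
  match k with inl i => u' i | inr i => x' i end.

(** [u' i] detects only the exponent of [x' i], and conversely; the inverse arises because [x' i]
    stands on the other side in [weyl_u_x]. *)
Definition xu_char (k : 'I_n + 'I_n) (j : J) : F :=
  match k with inl i => q ^+ j.1 i | inr i => (q ^+ j.2 i)^-1 end.

Let q0 : q != 0 := prim_root_neq0 ql.

Lemma xu_mon_qcomm k j : qcomm kappa (xu_char k j) (xu_gen k) (xu_mon j).
Proof.
have [_ dx' x'C d'C] := sys'.
case: k => i /=.
  rewrite -[X in qcomm _ X]mulr1; apply: qcommM => //.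
    by apply: qcomm_prod_eq => // h; apply: (weyl_u_x sys').
  apply/qcomm1/commr_prod => h _; apply/commrX; exact: (weyl_u_comm sys').
rewrite /qcomm; have xX : GRing.comm (x' i) (\prod_h x' h ^+ j.1 h).
  by apply: commr_prod => h _; apply: commrX.
have xU : qcomm kappa (q ^- j.2 i) (x' i) (\prod_h u' h ^+ j.2 h).
  rewrite -exprVn; apply: qcomm_prod_eq => // h.
  rewrite /qcomm; have := weyl_u_x sys' h i.
  rewrite /qcomm eq_sym => ->; rewrite mulrA -rmorphM exprVn mulVf ?expf_neq0//.
  by rewrite rmorph1 mul1r.
by rewrite /xu_mon mulrA xX -!mulrA xU !mulrA -[_ * kappa _]kC.
Qed.

(** Powers of [q] with exponents below its order [l] are distinct, so the scalars determine every
    exponent. *)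
Lemma xu_char_sep i j : i != j -> exists k, xu_char k i != xu_char k j.
Proof.
move=> ij; apply: contrapT => no; case/eqP: ij.
have ch k : xu_char k i = xu_char k j.
  by apply/eqP/negP => /negP h; apply: no; exists k.
have qinj (a b : 'I_l) : q ^+ a = q ^+ b -> a = b.
  move/eqP; rewrite (eq_prim_root_expr ql) !modn_small// => /eqP.
  exact: val_inj.
case: i j ch {no} => [i1 i2] [j1 j2] ch; congr pair; apply/ffunP => h.
  exact: qinj (ch (inl h)).
by apply: qinj; apply: invr_inj; exact: (ch (inr h)).
Qed.

Let one_neq0 : (1 : A) <> 0.
Proof.
rewrite -(weyl_nf1 kappa x d) -(raddf0 nf) => /nf_inj /eqP.
by rewrite oner_eq0.
Qed.

Lemma xu_mon_neq0 j : xu_mon j <> 0.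
Proof.
have pX a k : a <> 0 -> a ^+ k <> 0 :> A.
  by move=> a0; elim: k => [|k IH]; rewrite ?expr0// exprS => /dom[].
have pP (f : 'I_n -> A) : (forall i, f i <> 0) -> \prod_i f i <> 0.
  by move=> f0; elim/big_rec: _ => // i a _ a0 /dom[/f0|].
by move=> /dom[]; apply: pP => i; apply: pX.
Qed.

(** The [x' i] and [d' i] need not generate [A], but every [a] has a nonzero central multiple in the
    span of the [xu_mon j] over the image of [zeta], and the central factor cancels. *)
Lemma commutant_central w : (forall i, GRing.comm w (x' i)) ->
  (forall i, GRing.comm w (d' i)) -> forall a, GRing.comm w a.
Proof.
move=> wx wd a.
have wu i : GRing.comm w (u' i) by apply: commrB; apply: commrM.
have wxu j : GRing.comm w (xu_mon j).
  by apply: commrM; apply: commr_prod => i _; apply: commrX.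
(* [None] stands for [a]: there is one vector more than the [l ^ (n + n)] spanning elements of
   [zeta_span], which forces a relation. *)
pose g (j : option J) := if j is Some j then xu_mon j else a.
have [G gE] := choice (fun j => zeta_span (g j)).
have [|c [j0 cj0] cG] := idomain_kernel G.
  rewrite card_option card_prod !card_ffun !card_ord ltnS.
  by rewrite expnD.
have sum0 : \sum_j zeta (c j) * g j = 0.
  transitivity (\sum_e zeta (\sum_j c j * G j e) * mon (expo e)); last first.
    by rewrite big1// => e _; rewrite cG raddf0 mul0r.
  under eq_bigr do rewrite gE mulr_sumr.
  rewrite exchange_big; apply: eq_bigr => e _.
  rewrite raddf_sum/= mulr_suml; apply: eq_bigr => j _.
  by rewrite zetaM mulrA.
have sumE : zeta (c None) * a = - \sum_j zeta (c (Some j)) * xu_mon j.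
  apply/eqP; rewrite -addr_eq0 -[X in _ == X]sum0.
  rewrite [X in _ == X](bigD1 None)//=.
  rewrite [X in _ == _ + X](reindex_omap Some id) => [|[]//].
  by apply/eqP; congr (_ + _); apply: eq_bigl => j; rewrite /= eqxx.
(* Otherwise the relation involves only the [xu_mon j], whose independence makes every coefficient
   zero. *)
have cN : zeta (c None) <> 0.
  move=> cN0.
  have {}sumE : \sum_(j in [set: J]) zeta (c (Some j)) * xu_mon j = 0.
    transitivity (\sum_j zeta (c (Some j)) * xu_mon j).
      by apply: eq_bigl => j; rewrite inE.
    by apply: oppr_inj; rewrite -sumE cN0 mul0r oppr0.
  have z0 k : xu_gen k <> 0 by case: k.
  have cS j : c (Some j) = 0.
    (* A central coefficient leaves the eigenvalues unchanged. *)
    have ev k h : qcomm kappa (xu_char k h) (xu_gen k)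
        (zeta (c (Some h)) * xu_mon h).
      rewrite -[X in qcomm _ X]mul1r; apply: qcommM => //.
        by apply/qcomm1/commr_sym/zeta_central.
      exact: xu_mon_qcomm.
    have jT := finset.in_setT j.
    have := eigenvectors_sum_eq0 kC dom z0 xu_char_sep ev sumE jT.
    by move=> /dom[/zeta_inj//|/xu_mon_neq0].
  case: j0 cj0 => [j|]; first by rewrite cS eqxx.
  by rewrite (zeta_inj cN0) eqxx.
suff /dom[//|] : zeta (c None) * (w * a - a * w) = 0.
  by move/eqP; rewrite subr_eq0 => /eqP.
have wC : GRing.comm w (zeta (c None) * a).
  rewrite sumE; apply/commrN/commr_sum => j _; apply: commrM => //.
  exact/commr_sym/zeta_central.
by rewrite mulrBr [X in _ - X]mulrA -wC !mulrA zeta_central subrr.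
Qed.
End RootOfUnity.

(** * The quantized Weyl algebra and its specializations *)

Section LaurentEvaluation.
Variable F : fieldType.
Local Notation lp := (@laurent_poly F).

Fact laurent_poly_zmod : zmod_morphism lp.
Proof. by move=> p r; apply: val_inj; rewrite /= tofracB. Qed.
Fact laurent_poly_monoid : monoid_morphism lp.
Proof.
split=> [|p r]; apply: val_inj; first by rewrite /= tofrac1.
by rewrite /= tofracM.
Qed.
HB.instance Definition _ :=
  GRing.isZmodMorphism.Build {poly F} (laurent F) lp laurent_poly_zmod.
HB.instance Definition _ :=
  GRing.isMonoidMorphism.Build {poly F} (laurent F) lp laurent_poly_monoid.

Lemma laurent_poly_inj : injective lp.
Proof. by move=> p r /(congr1 val)/eqP; rewrite /= tofrac_eq => /eqP. Qed.

(** Quantifying over a pair lets [laurent_eval] choose numerator and exponent at once. *)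
Lemma laurentP (r : laurent F) : exists pk : {poly F} * nat,
  r * lp ('X^(pk.2)) = lp pk.1.
Proof.
case: r => r rP; have /asboolP[p [k rE]] := rP; exists (p, k); apply: val_inj.
by rewrite /= rE divfK// tofracXn_neq0.
Qed.

Variable q : F.
Hypothesis q0 : q != 0.

(* The proof argument only makes the ring morphism structure inferable. *)
Definition laurent_eval of q != 0 := fun r : laurent F =>
  let pk := projT1 (cid (laurentP r)) in pk.1.[q] / q ^+ pk.2.

Local Notation ev := (laurent_eval q0).

(** Two presentations of [r] cross-multiply to an identity of polynomials, so the value does not
    depend on the chosen one. *)
Lemma laurent_evalE r p k : r * lp 'X^k = lp p -> ev r = p.[q] / q ^+ k.
Proof.
rewrite /laurent_eval; case: (cid _) => -[p' k'] /= r' r0.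
have : p' * 'X^k = p * 'X^k'.
  by apply: laurent_poly_inj; rewrite !rmorphM/= -r' -r0 mulrAC.
move=> /(congr1 (horner^~ q)); rewrite !hornerM !hornerXn => pq.
by apply/eqP; rewrite eqr_div ?expf_neq0// pq.
Qed.

Lemma laurent_eval_zmod : zmod_morphism ev.
Proof.
move=> r s; have [[p k] /= rE] := laurentP r.
have [[p' k'] /= sE] := laurentP s.
rewrite (laurent_evalE rE) (laurent_evalE sE).
rewrite (@laurent_evalE _ (p * 'X^k' - p' * 'X^k) (k + k')).
  rewrite hornerD hornerN !hornerM !hornerXn exprD.
  by field; rewrite !expf_neq0.
by rewrite rmorphB !rmorphM/= -rE -sE exprD rmorphM /=; ring.
Qed.

Lemma laurent_eval_monoid : monoid_morphism ev.
Proof.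
split=> [|r s].
  by rewrite (@laurent_evalE _ 1 0) ?expr0 ?rmorph1 ?mulr1// hornerC divr1.
have [[p k] /= rE] := laurentP r; have [[p' k'] /= sE] := laurentP s.
rewrite (laurent_evalE rE) (laurent_evalE sE).
rewrite (@laurent_evalE _ (p * p') (k + k')).
  by rewrite hornerM exprD mulf_div.
by rewrite !rmorphM/= -rE -sE exprD rmorphM /=; ring.
Qed.
HB.instance Definition _ :=
  GRing.isZmodMorphism.Build (laurent F) F ev laurent_eval_zmod.
HB.instance Definition _ :=
  GRing.isMonoidMorphism.Build (laurent F) F ev laurent_eval_monoid.

Lemma laurent_eval_poly p : ev (lp p) = p.[q].
Proof. by rewrite (@laurent_evalE _ p 0) ?expr0 ?rmorph1 ?mulr1 ?divr1. Qed.

Lemma laurent_eval_var : ev (lvar F) = q.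
Proof. by rewrite laurent_eval_poly hornerX. Qed.
End LaurentEvaluation.

Lemma poly_roots_finite (F : fieldType) (p : {poly F}) :
  p != 0 -> finite_set [set q | root p q]%classic.
Proof.
have [m] := ubnP (size p); elim: m p => // m IH p; rewrite ltnS => pm p0.
have [[a /factor_theorem[r pE]]|noroot] := pselect (exists a, root p a);
  last first.
  apply: (@sub_finite_set _ _ set0) => // a pa; by apply: noroot; exists a.
have r0 : r != 0 by apply: contraNneq p0 => r0; rewrite pE r0 mul0r.
apply: (@sub_finite_set _ _ ([set b | root r b] `|` [set a])%classic).
  move=> b /=.
  by rewrite pE rootM root_XsubC => /orP[rb|/eqP ->]; [left|right].
rewrite finite_setU; split=> //; apply: IH => //.
by rewrite pE size_Mmonic ?monicXsubC// size_XsubC addn2 /= in pm.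
Qed.

(** At a nonzero [q] the denominator, a power of [t], does not vanish, so the zeros are roots of the
    numerator. *)
Lemma laurent_roots_finite (F : fieldType) (r : laurent F) : r != 0 ->
  finite_set [set q : F | exists q0 : q != 0, laurent_eval q0 r = 0]%classic.
Proof.
move=> r0; have [[p k] /= rE] := laurentP r.
have p0 : p != 0.
  apply: contraNneq r0 => p0; rewrite -(inj_eq val_inj).
  move: rE; rewrite p0 rmorph0 => /(congr1 (@laurent_val F))/eqP.
  by rewrite rmorphM rmorph0 /= mulf_eq0 (negbTE (tofracXn_neq0 _ _)) orbF.
apply: sub_finite_set (poly_roots_finite p0) => q [q0] /=.
rewrite (laurent_evalE _ rE) => /eqP; rewrite mulf_eq0 invr_eq0 expf_eq0.
by rewrite (negbTE q0) andbF orbF.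
Qed.

(** * Presentations and the representation of the specialized algebra *)

Section QuotientLift.
Variables (A B : pzRingType) (S : set A) (f : {rmorphism A -> B}).
Hypothesis fS : forall s, S s -> f s = 0.

Lemma quot_lift : exists g : {rmorphism quot_ring S -> B},
  forall a, g (quot_proj S a) = f a.
Proof.
have f0 a : ideal_gen S a -> f a = 0.
  move: a; suff: (ideal_gen S `<=` [set a | f a = 0])%classic by [].
  apply: ideal_gen_min => //; split=> /= [|u v fu fv|u v w fv].
  - exact: rmorph0.
  - by rewrite rmorphB fu fv subrr.
  - by rewrite !rmorphM fv mulr0 mul0r.
pose g (z : quot_ring S) := f (repr z).
have gE a : g (quot_proj S a) = f a.
  by apply/eqP; rewrite -subr_eq0 -rmorphB f0//; apply: quot_repr.
have gB : zmod_morphism g.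
  move=> u v; rewrite -[u]quot_projK -[v]quot_projK -raddfB !gE.
  exact: raddfB.
have gM : monoid_morphism g.
  split=> [|u v]; first by rewrite -(rmorph1 (quot_proj S)) gE rmorph1.
  by rewrite -[u]quot_projK -[v]quot_projK -rmorphM !gE rmorphM.
pose G : {rmorphism quot_ring S -> B} := HB.pack g
  (GRing.isZmodMorphism.Build _ _ _ gB) (GRing.isMonoidMorphism.Build _ _ _ gM).
by exists G.
Qed.
End QuotientLift.

Section FreeAlgebra.
Import monalg.
Variables (R : comNzRingType) (n : nat).
Local Notation gens := ('I_n + 'I_n)%type.
Local Notation free_alg := {malg R[{fmonom gens}]}.

Definition free_gen (g : gens) : free_alg :=
  match g with inl i => free_x R i | inr i => free_d R i end.

Lemma free_alg_ind (Q : free_alg -> Prop) :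
  Q 1 -> (forall a b, Q a -> Q b -> Q (a + b)) ->
  (forall c a, Q a -> Q (c *: a)) -> (forall g a, Q a -> Q (free_gen g * a)) ->
  forall a, Q a.
Proof.
move=> Q1 QD QZ QM a.
have Q0 : Q 0 by rewrite -(scale0r 1); apply: QZ.
have QU (m : {fmonom gens}) : Q (mkmalgU m 1).
  case: m => s; elim: s => [|g s IH]; first by rewrite -fmoneE.
  have -> : mkmalgU (FMonom (g :: s)) 1 =
      free_gen g * mkmalgU (FMonom s) 1 :> free_alg.
    have -> : free_gen g = mkmalgU (fmu g) 1 by case: g.
    rewrite malgM_def fgmulUU mulr1 fmuE; congr mkmalgU.
    by rewrite -[RHS]/(fmmul _ _) fmmulE.
  exact: QM.
rewrite (monalgE a); apply: big_ind => // m _.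
suff -> : mkmalgU m (mcoeff m a) = mcoeff m a *: mkmalgU m 1 :> free_alg.
  exact: QZ.
by apply/malgP => h; rewrite mcoeffZ !mcoeffU mulrnAr mulr1.
Qed.

Section Lift.
Variables (E : nzRingType) (f : {rmorphism R -> E}) (h : gens -> E).
Hypothesis fh : forall c g, GRing.comm (f c) (h g).

Let hm (m : {fmonom gens}) : E := \prod_(g <- (m : seq _)) h g.

Fact free_lift_mmorph : mmorphism hm.
Proof.
by split=> [u v|]; rewrite /hm ?fmM ?big_cat ?fm1 ?big_nil.
Qed.

(** As [E] may be noncommutative, multiplicativity rests on [fh]: images of scalars commute with
    images of words. *)
Lemma free_lift : exists g : {rmorphism free_alg -> E},
  (forall c a, g (c *: a) = f c * g a) /\ forall k, g (free_gen k) = h k.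
Proof.
pose H : {mmorphism {fmonom gens} -> E} :=
  HB.pack hm (isMultiplicative.Build _ _ hm free_lift_mmorph).
have MM : monoid_morphism (mmap f H).
  have [] := @commr_mmap_is_multiplicative _ _ _ f H _.
    by move=> a m m'; apply: commr_prod.
  by move=> ? ?; split.
pose G : {rmorphism free_alg -> E} :=
  HB.pack (mmap f H) (GRing.isMonoidMorphism.Build _ _ (mmap f H) MM).
exists G; split=> [c a|k]; first exact: mmapZ.
have -> : free_gen k = mkmalgU (fmu k) 1 by case: k.
by rewrite /= mmapU /= rmorph1 mul1r /hm fmU big_seq1.
Qed.
End Lift.
End FreeAlgebra.

(* Declared before monalg is imported, which redefines [{mpoly _[_]}]. *)
Local Notation pbw_module F n := {mpoly F[n + n]}.

Section WeylQuotient.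
Variables (R : comNzRingType) (t : R) (n : nat) (A : lalgType R).
Variables (x d : 'I_n -> A).
Local Notation pi := (quot_proj (weyl_rel t x d)).

Lemma weyl_rel_eq0 r : weyl_rel t x d r -> pi r = 0.
Proof.
move=> rr; rewrite -quot_proj0; apply/quot_projE; rewrite subr0.
exact: sub_ideal_gen.
Qed.

Lemma weyl_quot_dx i j :
  pi (d i) * pi (x j) = t ^+ (i == j) *: (pi (x j) * pi (d i)) + (i == j)%:R.
Proof.
have /weyl_rel_eq0 : weyl_rel t x d
    (d i * x j - t ^+ (i == j) *: (x j * d i) - (i == j)%:R).
  by exists i, j; apply: Or31.
rewrite !raddfB /= => /subr0_eq /(canRL (subrK _)).
by rewrite linearZ /= !rmorphM rmorph_nat addrC.
Qed.

Lemma weyl_quot_xx i j : GRing.comm (pi (x i)) (pi (x j)).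
Proof.
have /weyl_rel_eq0 : weyl_rel t x d (x i * x j - x j * x i).
  by exists i, j; apply: Or32.
by rewrite raddfB /= => /subr0_eq; rewrite !rmorphM.
Qed.

Lemma weyl_quot_dd i j : GRing.comm (pi (d i)) (pi (d j)).
Proof.
have /weyl_rel_eq0 : weyl_rel t x d (d i * d j - d j * d i).
  by exists i, j; apply: Or33.
by rewrite raddfB /= => /subr0_eq; rewrite !rmorphM.
Qed.

Lemma weyl_quot_lift (E : pzRingType) (f : {rmorphism R -> E})
    (g : {rmorphism A -> E}) : (forall c a, g (c *: a) = f c * g a) ->
  (forall i j, g (d i) * g (x j) =
    f (t ^+ (i == j)) * (g (x j) * g (d i)) + (i == j)%:R) ->
  (forall i j, GRing.comm (g (x i)) (g (x j))) ->
  (forall i j, GRing.comm (g (d i)) (g (d j))) ->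
  exists h : {rmorphism quot_ring (weyl_rel t x d) -> E},
    forall a, h (pi a) = g a.
Proof.
move=> gZ gdx gxx gdd; apply: quot_lift => _ [i [j []->]].
- by rewrite !rmorphB /= gZ !rmorphM rmorph_nat gdx addrAC addrK subrr.
- by rewrite rmorphB !rmorphM /= gxx subrr.
- by rewrite rmorphB !rmorphM /= gdd subrr.
Qed.
End WeylQuotient.

Section QWeyl.
Import monalg.
Variables (F : fieldType) (n : nat).
Local Notation R := (laurent F).
Local Notation t := (lvar F).
Local Notation B := (qweyl F n).
Local Notation rel := (weyl_rel t (@free_x R n) (@free_d R n)).
Local Notation kR := (@GRing.in_alg R B).

Definition qweyl_pi : {malg R[{fmonom ('I_n + 'I_n)%type}]} -> B :=
  quot_proj rel.
HB.instance Definition _ := GRing.RMorphism.copy qweyl_pi (quot_proj rel).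

Lemma qweyl_piM u v : qweyl_pi (u * v) = qweyl_pi u * qweyl_pi v.
Proof. exact: (quot_proj_monoid rel).2. Qed.

Lemma qweyl_piZ c u : qweyl_pi (c *: u) = c *: qweyl_pi u.
Proof. exact: quot_proj_scalable. Qed.

Lemma qweyl_pi_surj (a : B) : exists u, qweyl_pi u = a.
Proof. by exists (repr (a : quot_ring rel)); apply: quot_projK. Qed.

Definition qx i : B := qweyl_pi (free_x R i).
Definition qd i : B := qweyl_pi (free_d R i).

Lemma qweyl_system : weyl_system t kR qx qd.
Proof.
split=> [c a|i j|i j|i j].
- by rewrite /GRing.comm /= mulr_algl mulr_algr.
- rewrite /= mulr_algl; exact: weyl_quot_dx.
- exact: weyl_quot_xx.
- exact: weyl_quot_dd.
Qed.

Lemma qweyl_generated : weyl_generated kR qx qd.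
Proof.
move=> Q Q1 QD QZ Qx Qd a; have [u <-] := qweyl_pi_surj a; move: u.
apply: free_alg_ind => [|u v Qu Qv|c u Qu|[i|i] u Qu].
- by rewrite rmorph1.
- by rewrite raddfD; apply: QD.
- by rewrite qweyl_piZ -mulr_algl; apply: QZ.
- by rewrite qweyl_piM; apply: Qx.
- by rewrite qweyl_piM; apply: Qd.
Qed.

Section At.
Variable q : F.
Hypothesis q0 : q != 0.
Local Notation Bq := (qweyl_at n q).
Local Notation pr := (@qweyl_proj F n q).

(** [Bq] is declared as a module over the Laurent ring; constant Laurent polynomials supply its
    scalars from [F]. *)
Definition kq : F -> Bq := pr \o kR \o @laurent_poly F \o polyC.
HB.instance Definition _ :=
  GRing.RMorphism.copy kq (pr \o kR \o @laurent_poly F \o polyC).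

(** The quotient identifies [t] with [q]; this extends to polynomials by induction, and to
    denominators because [q ^+ k] is invertible. *)
Lemma qweyl_proj_alg r : pr r%:A = kq (laurent_eval q0 r).
Proof.
have prt : pr t%:A = kq q.
  apply/quot_projE; rewrite -scalerBl; exact: sub_ideal_gen.
have prp p : pr (laurent_poly p)%:A = kq p.[q].
  elim/poly_ind: p => [|p c IH].
    by rewrite horner0 !rmorph0 -/(kR 0) !rmorph0.
  rewrite hornerMXaddC -[(_)%:A]/(kR _) !(rmorphD, rmorphM) /=.
  by rewrite -IH -prt.
have [[p k] /= rE] := laurentP r.
rewrite (laurent_evalE q0 rE).
have qk : q ^+ k != 0 by rewrite expf_neq0.
have := prp p; rewrite -rE -[(_)%:A]/(kR _) !rmorphM /=.
have := prp 'X^k; rewrite -[(_)%:A]/(kR _) hornerXn => -> E.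
by rewrite -E -mulrA -rmorphM mulfV// rmorph1 mulr1.
Qed.

Lemma qweyl_at_surj (z : Bq) : exists a, pr a = z.
Proof. by exists (repr z); apply: quot_projK. Qed.

Lemma kq_central c z : GRing.comm (kq c) z.
Proof.
have [a <-] := qweyl_at_surj z; have [kC _ _ _] := qweyl_system.
by have := congr1 pr (kC (lconst c) a); rewrite !rmorphM.
Qed.

Lemma weyl_system_proj (x d : 'I_n -> B) :
  weyl_system t kR x d -> weyl_system q kq (pr \o x) (pr \o d).
Proof.
move=> [_ dx xC dC]; split=> [c a|i j|i j|i j]; first exact: kq_central.
- rewrite /= -rmorphM dx rmorphD rmorph_nat rmorphM rmorphM.
  rewrite /= qweyl_proj_alg rmorphXn /=.
  by rewrite laurent_eval_var.
- by rewrite /GRing.comm /= -!rmorphM xC.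
- by rewrite /GRing.comm /= -!rmorphM dC.
Qed.

Lemma qweyl_at_generated : weyl_generated kq (pr \o qx) (pr \o qd).
Proof.
move=> Q Q1 QD QZ Qx Qd z; have [a <-] := qweyl_at_surj z; move: a.
apply: qweyl_generated => [|a b Qa Qb|c a Qa|i a Qa|i a Qa].
- by rewrite rmorph1.
- by rewrite raddfD; apply: QD.
- by rewrite rmorphM /= qweyl_proj_alg; apply: QZ.
- by rewrite rmorphM; apply: Qx.
- by rewrite rmorphM; apply: Qd.
Qed.

(** With injectivity of normal forms at [q], this turns vanishing of a reduction into vanishing of
    all coefficients at [q]. *)
Lemma weyl_nf_proj p : pr (weyl_nf kR qx qd p) =
  weyl_nf kq (pr \o qx) (pr \o qd) (map_mpoly (laurent_eval q0) p).
Proof.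
elim/mpolyind: p => [|c m p _ _ IH]; first by rewrite !raddf0.
rewrite !raddfD/= IH; congr (_ + _).
rewrite weyl_nfZ weyl_nfX map_mpolyZ map_mpolyX weyl_nfZ weyl_nfX.
rewrite rmorphM /= qweyl_proj_alg; congr (_ * _).
rewrite rmorphM !rmorph_prod; congr (_ * _);
  by apply: eq_bigr => i _; rewrite rmorphXn.
Qed.

(** Built in three stages: on the free algebra, modulo the Weyl relations, then modulo [t - q],
    which acts as [q - q]. *)
Lemma qweyl_at_rho : exists rho : {rmorphism Bq -> endo (pbw_module F n)},
  [/\ forall c, rho (kq c) = endo_scale n c,
      forall i, rho (pr (qx i)) = endo_x F i
    & forall i, rho (pr (qd i)) = endo_d q i].
Proof.
pose h (g : 'I_n + 'I_n) :=
  match g with inl i => endo_x F i | inr i => endo_d q i end.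
pose f : {rmorphism R -> endo (pbw_module F n)} :=
  endo_scale n \o laurent_eval q0.
have [|g0 [g0Z g0g]] := @free_lift R n _ f h.
  by move=> c [i|i]; [apply: endo_scale_x|apply: endo_scale_d].
have g0x i : g0 (free_x R i) = endo_x F i := g0g (inl i).
have g0d i : g0 (free_d R i) = endo_d q i := g0g (inr i).
have dx0 i j : g0 (free_d R i) * g0 (free_x R j) =
    f (t ^+ (i == j)) * (g0 (free_x R j) * g0 (free_d R i)) + (i == j)%:R.
  by rewrite g0x g0d endo_dx /= [laurent_eval q0 _]rmorphXn /= laurent_eval_var.
have xx0 i j : GRing.comm (g0 (free_x R i)) (g0 (free_x R j)).
  by rewrite !g0x; apply: endo_x_comm.
have dd0 i j : GRing.comm (g0 (free_d R i)) (g0 (free_d R j)).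
  by rewrite !g0d; apply: endo_d_comm.
have [g1 g1E] : exists g1 : {rmorphism B -> endo (pbw_module F n)},
    forall a, g1 (qweyl_pi a) = g0 a := weyl_quot_lift g0Z dx0 xx0 dd0.
have g1Z (c : R) : g1 c%:A = f c.
  by rewrite -[1 : B](rmorph1 qweyl_pi) -qweyl_piZ g1E g0Z rmorph1 mulr1.
have g1t s : [set (t - lconst q)%:A : B]%classic s -> g1 s = 0.
  move=> ->; rewrite g1Z rmorphB /= laurent_eval_var laurent_eval_poly hornerC.
  by rewrite subrr.
have [g2 g2E] : exists g2 : {rmorphism Bq -> endo (pbw_module F n)},
    forall a, g2 (pr a) = g1 a := quot_lift g1t.
exists g2; split=> [c|i|i].
- by rewrite g2E g1Z /= laurent_eval_poly hornerC.
- by rewrite g2E g1E.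
- by rewrite g2E g1E.
Qed.

Lemma qweyl_at_nf_inj : injective (weyl_nf kq (pr \o qx) (pr \o qd)).
Proof.
by have [rho [rk rx rd]] := qweyl_at_rho; apply: (weyl_nf_inj q0 rk rx rd).
Qed.

Lemma qweyl_at_domain (a b : Bq) : a * b = 0 -> a = 0 \/ b = 0.
Proof.
have [rho [rk rx rd]] := qweyl_at_rho; apply: (weyl_domain q0 rk rx rd).
exact: weyl_nf_surj (weyl_system_proj qweyl_system) qweyl_at_generated.
Qed.
End At.
End QWeyl.

(** * The induced endomorphism and the exceptional roots of unity *)

Section Endomorphism.
Variables (F : fieldType) (n : nat).
Local Notation R := (laurent F).
Local Notation t := (lvar F).
Local Notation B := (qweyl F n).
Local Notation kR := (@GRing.in_alg R B).
Variable phi : {lrmorphism B -> B}.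
Local Notation u' := (weyl_u (phi \o @qx F n) (phi \o @qd F n)).
Local Notation nfq q := (weyl_nf (@kq F n q)
  (@qweyl_proj F n q \o @qx F n) (@qweyl_proj F n q \o @qd F n)).

Lemma qweyl_at_oner_neq0 (q : F) : q != 0 -> (1 : qweyl_at n q) <> 0.
Proof.
move=> q0; rewrite -(weyl_nf1 (@kq F n q) (@qweyl_proj F n q \o @qx F n)
  (@qweyl_proj F n q \o @qd F n)) -(raddf0 (nfq q)).
by move=> /(qweyl_at_nf_inj q0)/eqP; rewrite oner_eq0.
Qed.

Lemma weyl_system_phi : weyl_system t kR (phi \o @qx F n) (phi \o @qd F n).
Proof.
have [kC dx xC dC] := @qweyl_system F n.
have phik (c : R) : phi c%:A = c%:A by rewrite linearZ rmorph1.
split=> // i j.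
- have := congr1 phi (dx i j).
  by rewrite rmorphM rmorphD !rmorphM rmorph_nat /= phik.
- by have := congr1 phi (xC i j); rewrite !rmorphM.
- by have := congr1 phi (dC i j); rewrite !rmorphM.
Qed.

(** If [x i] vanished, the relation between [d i] and [x i] would read [0 = 1]. *)
Lemma weyl_system_neq0 (q : F) (x d : 'I_n -> qweyl_at n q) i : q != 0 ->
  weyl_system q (@kq F n q) x d -> x i <> 0.
Proof.
move=> q0 [_ dx _ _] x0; have := dx i i.
rewrite x0 eqxx mulr0 mul0r mulr0 add0r.
by move/esym/(qweyl_at_oner_neq0 q0).
Qed.

(* [r] is a coefficient of the normal form of [u' i], which is nonzero because
   [u' i] becomes 1 at t = 1. *)
Lemma phi_u_witness i : exists r : R, r != 0 /\
  forall (q : F) (q0 : q != 0),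
    qweyl_proj q (u' i) = 0 -> laurent_eval q0 r = 0.
Proof.
have [p pE] := weyl_nf_surj (@qweyl_system F n) (@qweyl_generated F n) (u' i).
exists p@_(mlead p); split.
  rewrite mleadc_eq0; apply/eqP => p0; have one0 : (1 : F) != 0 := oner_neq0 F.
  apply: (qweyl_at_oner_neq0 one0).
  have [_ dx _ _] := weyl_system_proj one0 weyl_system_phi.
  transitivity (qweyl_proj 1 (u' i)); last by rewrite -pE p0 !raddf0.
  rewrite rmorphB !rmorphM.
  have := dx i i; rewrite eqxx expr1 rmorph1 mul1r /= => ->.
  by rewrite addrC addKr.
move=> q q0; rewrite -pE (weyl_nf_proj q0) -(raddf0 (nfq q)).
by move=> /(qweyl_at_nf_inj q0) mp0; rewrite -mcoeff_map_mpoly mp0 mcoeff0.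
Qed.

Lemma induced_center (q : F) l : l.-primitive_root q -> (1 < l)%N ->
  (forall i, qweyl_proj q (u' i) <> 0) ->
  forall z, center (qweyl_at n q) z ->
    center (qweyl_at n q) (qweyl_induced phi z).
Proof.
move=> ql l1 u0 z zC a.
have q0 := prim_root_neq0 ql.
have sysq := weyl_system_proj q0 (@qweyl_system F n).
have sysphi := weyl_system_proj q0 weyl_system_phi.
(* Centrality of [z] yields commutation with the image of the induced map only; [commutant_central]
   extends it to the whole algebra. *)
have phiC b :
    GRing.comm (qweyl_induced phi z : qweyl_at n q) (qweyl_proj q (phi b)).
  by rewrite -qweyl_inducedE /GRing.comm -!rmorphM zC.
apply: (commutant_central ql l1 sysq (qweyl_at_generated q0)
  (qweyl_at_nf_inj q0) (qweyl_at_domain q0) sysphi).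
- by move=> i; apply: weyl_system_neq0 sysphi.
- by move=> i; have := u0 i; rewrite rmorphB !rmorphM.
- by move=> i; apply: phiC.
- by move=> i; apply: phiC.
Qed.

Lemma finite_noncentral : finite_set [set q : F | is_root_of_unity q /\
    ~ ([set qweyl_induced phi z | z in center (qweyl_at n q)]
         `<=` center (qweyl_at n q))]%classic.
Proof.
have [r rP] := choice phi_u_witness.
(* The possible exceptions are [q = 1], whose order is not above 1, and the zeros of the [n]
   witnesses [r i]. *)
apply: (@sub_finite_set _ _ ([set 1] `|` \bigcup_(i in [set: 'I_n])
    [set q | exists q0 : q != 0, laurent_eval q0 (r i) = 0])%classic).
  move=> q [[m m0 /unity_rootP qm] nsub].
  have [l ql _] := prim_order_exists m0 qm.
  have [->|q1] := eqVneq q 1; first by left.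
  right; apply: contrapT => nroot; apply: nsub => _ [z zC <-].
  have q0 := prim_root_neq0 ql.
  have l1 : (1 < l)%N.
    case: l ql (prim_order_gt0 ql) => [|[|l]]// ql _.
    by move: (prim_expr_order ql) q1; rewrite expr1 => ->; rewrite eqxx.
  apply: (induced_center ql l1) => // i ui0; apply: nroot.
  by exists i => //; exists q0; apply: (rP i).2.
rewrite finite_setU; split; first exact: finite_set1.
apply: bigcup_finite => // i _; exact: laurent_roots_finite (rP i).1.
Qed.
End Endomorphism.

Local Open Scope classical_set_scope.
Local Open Scope complex_scope.

Theorem theorem2p7 (K : realType) (n : nat) (hn : (1 <= n)%N)
    (phi : {lrmorphism qweyl K[i] n -> qweyl K[i] n}) :
  finite_set [set q : K[i] | is_root_of_unity q /\
    ~ ([set qweyl_induced phi z | z in center (qweyl_at n q)]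
         `<=` center (qweyl_at n q))].
Proof. exact: finite_noncentral. Qed.
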